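(* Let $\mathcal{H}$ be a complex Hilbert space. For $T\in\boldsymbol{B}(\mathcal{H})$, the following conditions are equivalent: (i) $T$ is CPD and $\operatorname{supp}(M)=\{0\}$, where $M$ is the semispectral measure associated with $T$; (ii) $\mathcal{B}_2(T)T=0$, $\mathcal{B}_2(T)\geq0$ and $\mathcal{B}_2(T)\neq0$; (iii) $T^{*n}T^n=I-\mathcal{B}_2(T)+n(\mathcal{B}_2(T)-\mathcal{B}_1(T))$ for all integers $n\geq1$, $\mathcal{B}_2(T)\geq0$ and $\mathcal{B}_2(T)\neq0$; (iv) there exist a semispectral measure $F\colon\mathfrak{B}(\mathbb{R}_+)\to\boldsymbol{B}(\mathcal{H})$ with $\operatorname{supp}(F)=\{0\}$ and a selfadjoint operator $D\in\boldsymbol{B}(\mathcal{H})$ such that $F([1,\infty))=0$, $\frac{1}{1-x}\in L^1(F)$ and $$T^{*n}T^n=I+nD-\int_{[0,1)}\frac{1-x^n}{(1-x)^2}\,F(\mathrm{d}x),\quad n\in\mathbb{Z}_+.$$ Moreover, if (i) holds, then (a) $r(T)=1$ whenever $T\neq0$; (b) $T$ is subnormal if and only if $\mathcal{B}_1(T)T=0$ and $\|T\|\leq1$; if this is the case, then $\|T\|=1$ provided $T\neq0$.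
   Context: $\boldsymbol{B}(\mathcal{H})$ is the algebra of bounded linear operators on $\mathcal{H}$; $\mathbb{Z}_+=\{0,1,2,\ldots\}$, $\mathbb{R}_+=[0,\infty)$; $\mathfrak{B}(\mathbb{R}_+)$ is the Borel $\sigma$-algebra; $\operatorname{supp}$ is the closed support; $r(T)$ is the spectral radius. In the integrals, $x^n$ for $n=0$ is the constant function $1$. $\mathcal{B}_1(T)=I-T^*T$, $\mathcal{B}_2(T)=I-2T^*T+T^{*2}T^2$. $T\in\boldsymbol{B}(\mathcal{H})$ is subnormal if there are a complex Hilbert space $\mathcal{K}\supseteq\mathcal{H}$ (isometric embedding) and a normal operator $N\in\boldsymbol{B}(\mathcal{K})$ with $Th=Nh$ for all $h\in\mathcal{H}$. A real sequence $\{\gamma_n\}_{n=0}^\infty$ is conditionally positive definite (CPD) if $\sum_{i,j=0}^k \gamma_{i+j}\lambda_i\bar\lambda_j\geq 0$ for all finite complex sequences $\lambda_0,\ldots,\lambda_k$ with $\sum_{i=0}^k\lambda_i=0$. $T\in\boldsymbol{B}(\mathcal{H})$ is CPD if $\{\|T^nh\|^2\}_{n=0}^\infty$ is CPD for every $h\in\mathcal{H}$. A semispectral measure $M\colon\mathfrak{B}(\mathbb{R}_+)\to\boldsymbol{B}(\mathcal{H})$ is a map that is $\sigma$-additive in the weak operator topology with $M(\Delta)\geq0$ for all $\Delta$ (no normalization). $L^1(M)$ is the space of complex Borel $\zeta$ with $\int|\zeta(x)|\langle M(\mathrm{d}x)h,h\rangle<\infty$ for all $h$; $\int\zeta\,\mathrm{d}M$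 is the unique bounded operator with $\langle(\int\zeta\,\mathrm{d}M)h,h\rangle=\int\zeta(x)\langle M(\mathrm{d}x)h,h\rangle$ for all $h$. For a CPD operator $T$, the semispectral measure $M$ associated with $T$ is the (unique, existing) compactly supported semispectral measure $M\colon\mathfrak{B}(\mathbb{R}_+)\to\boldsymbol{B}(\mathcal{H})$ with $p\langle T\rangle=p(1)I-p'(1)\mathcal{B}_1(T)+\int_{\mathbb{R}_+}\frac{p(x)-p(1)-p'(1)(x-1)}{(x-1)^2}M(\mathrm{d}x)$ for all $p\in\mathbb{C}[X]$ (the integrand being a polynomial), where $p\langle T\rangle=\sum_i\alpha_iT^{*i}T^i$ for $p=\sum_i\alpha_iX^i$. *)

(* Defs.v *)
From HB Require Import structures.
From mathcomp Require Import all_boot all_order all_algebra.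
From mathcomp Require Import all_classical all_reals all_analysis.
From mathcomp Require Import complex.

Set Implicit Arguments.
Unset Strict Implicit.
Unset Printing Implicit Defensive.

Import Order.TTheory GRing.Theory Num.Theory.
Import numFieldNormedType.Exports.

Local Open Scope classical_set_scope.
Local Open Scope ring_scope.
Local Open Scope complex_scope.

(* A complex Hilbert space: a Banach space over R[i] whose norm comes from an
   inner product, linear in its first argument and conjugate-linear in the
   second. *)
HB.mixin Record isHilbert (R : realType) H & CompleteNormedModule R[i] H := {
  inner : {dot H for (@Num.conj R[i])};
  inner_normE : forall h : H, inner h h = `|h| ^+ 2
}.

#[short(type="hilbertType")]
HB.structure Definition Hilbert (R : realType) :=
  {H of CompleteNormedModule R[i] H & isHilbert R H}.

Notation "''[' u , v ]" := (inner u v) (format "''[' u ,  v ]") : ring_scope.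

Section Operators.
Context {R : realType}.
Implicit Types (H K : hilbertType R).

(* Norms in a normedModType over R[i] are R[i]-valued (real and nonnegative);
   hnorm is the same number seen in R. *)
Definition hnorm H (h : H) : R := complex.Re `|h|.

(* B(H, K) is this predicate on functions H -> K; sums and scalings are those
   of the pointwise lmodType of functions, products are compositions. *)
Definition bounded_operator H K (T : H -> K) : Prop :=
  linear T /\ exists c : R, forall h, hnorm (T h) <= c * hnorm h.

Definition opnorm H (T : H -> H) : R :=
  sup [set hnorm (T h) | h in [set h | hnorm h <= 1]].

Definition is_adjoint H (T S : H -> H) : Prop :=
  forall h k, '[T h, k] = '[h, S k].

(* The bounded operator S with <Th, k> = <h, Sk>, which exists for bounded T
   by the Riesz representation theorem and is unique; 0 is only the default
   when T is not bounded. *)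
Definition adjoint H (T : H -> H) : H -> H :=
  xget 0 [set S | bounded_operator S /\ is_adjoint T S].

Definition positive_operator H (A : H -> H) : Prop := forall h, 0 <= '[A h, h].

Definition selfadjoint H (A : H -> H) : Prop := adjoint A = A.

Definition normal_operator H (N : H -> H) : Prop :=
  adjoint N \o N = N \o adjoint N.

Definition subnormal H (T : H -> H) : Prop :=
  exists (K : hilbertType R) (V : H -> K) (N : K -> K),
    [/\ linear V, forall h, `|V h| = `|h|,
        bounded_operator N, normal_operator N &
        forall h, V (T h) = N (V h)].

Definition spectrum H (T : H -> H) : set R[i] :=
  [set z | ~ exists S : H -> H, [/\ bounded_operator S,
                                    S \o (T - z *: idfun) = idfun &
                                    (T - z *: idfun) \o S = idfun]].

Definition spectral_radius H (T : H -> H) : R :=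
  sup [set complex.Re `|z| | z in spectrum T].

(* T^{*n} T^n *)
Definition hpow H (T : H -> H) (n : nat) : H -> H :=
  iter n (adjoint T) \o iter n T.

Definition B1 H (T : H -> H) : H -> H := idfun - hpow T 1.

Definition B2 H (T : H -> H) : H -> H := idfun - hpow T 1 *+ 2 + hpow T 2.

(* p<T> *)
Definition hereditary H (p : {poly R[i]}) (T : H -> H) : H -> H :=
  \sum_(i < size p) p`_i *: hpow T i.

Definition CPD_seq (g : nat -> R) : Prop :=
  forall (k : nat) (l : 'I_k.+1 -> R[i]), \sum_i l i = 0 ->
    0 <= \sum_(i < k.+1) \sum_(j < k.+1)
           (g (i + j)%N)%:C * l i * Num.conj (l j).

Definition CPD H (T : H -> H) : Prop :=
  forall h, CPD_seq (fun n => hnorm (iter n T h) ^+ 2).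

End Operators.

Definition Rplus {R : realType} : set R := `[0, +oo[.

(* A semispectral measure on the Borel sets of [0, +oo[, represented by its
   extension by 0 to the Borel sets of R.  As for the measures of the library,
   the values at non-measurable sets are irrelevant. The topology on R[i] is
   carried by the alias R[i]^o. *)
Record semispectral (R : realType) (H : hilbertType R) := Semispectral {
  smeas :> set R -> H -> H ;
  smeas_bounded : forall D, bounded_operator (smeas D) ;
  smeas_ge0 : forall D, positive_operator (smeas D) ;
  smeas_sigma_additive : forall F : nat -> set R,
    (forall n, measurable (F n)) -> trivIset setT F ->
    forall h k,
      (fun n => \sum_(0 <= i < n) '[smeas (F i) h, k] : R[i]^o) @ \oo
        --> ('[smeas (\bigcup_n F n) h, k] : R[i]^o) ;
  smeas_Rplus : smeas (~` Rplus) = 0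
}.

Section ScalarMeasure.
Context {R : realType} {H : hilbertType R}.
Variables (M : semispectral H) (h : H).

(* <M(-)h, h> *)
Definition scalar_measure (D : set R) : \bar R :=
  (complex.Re '[M D h, h])%:E.

Lemma Re_cvg (u : nat -> R[i]) (l : R[i]) :
  (u : nat -> R[i]^o) @ \oo --> (l : R[i]^o) ->
  (fun n => complex.Re (u n)) @ \oo --> complex.Re l.
Proof.
move=> /cvgrPdist_lt ul; apply/cvgrPdist_lt => e e0.
have e0C : 0 < (e%:C : R[i]) by rewrite ltcR.
have := ul _ e0C; apply: filterS => n /=.
have -> : complex.Re l - complex.Re (u n) = complex.Re (l - u n).
  by case: l {ul} => ? ?; case: (u n).
by rewrite -ltcR; apply: le_lt_trans; exact: normc_ge_Re.
Qed.

Lemma scalar_measure_sum (F : nat -> set R) n :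
  \sum_(0 <= i < n) scalar_measure (F i) =
  (complex.Re (\sum_(0 <= i < n) '[M (F i) h, h]))%:E.
Proof.
elim: n => [|n IH]; first by rewrite !big_geq.
rewrite !big_nat_recr //= IH -EFinD; congr (_%:E).
by case: (\sum_(_ <= _ < _) _) => ? ?; case: '[_, _].
Qed.

Lemma scalar_measure_ge0 D : (0 <= scalar_measure D)%E.
Proof.
rewrite lee_fin; have := @smeas_ge0 _ _ M D h.
by rewrite lecE => /andP[_].
Qed.

Lemma scalar_measure_sigma_additive : semi_sigma_additive scalar_measure.
Proof.
move=> F mF tF mUF.
have /Re_cvg := @smeas_sigma_additive _ _ M _ mF tF h h => cF.
rewrite (_ : (fun _ => _) = EFin \o
  (fun n => complex.Re (\sum_(0 <= i < n) '[M (F i) h, h]))); last first.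
  by apply/funext => n; rewrite /= scalar_measure_sum.
by apply: cvg_comp; first exact: cF.
Qed.

Lemma scalar_measure0 : scalar_measure set0 = 0%E.
Proof.
have mF : forall n : nat, measurable ((fun=> set0 : set R) n) by [].
have tF : trivIset setT (fun _ : nat => set0 : set R).
  by apply/trivIsetP => *; rewrite set0I.
have /Re_cvg := @smeas_sigma_additive _ _ M _ mF tF h h.
rewrite (_ : \bigcup_n _ = set0) => [c|]; last exact: bigcup0.
set a := complex.Re '[M set0 h, h] in c *.
have E n : complex.Re (\sum_(0 <= i < n) '[M set0 h, h]) = a *+ n.
  elim: n => [|n IH]; first by rewrite big_geq.
  rewrite big_nat_recr //= mulrSr -IH /a.
  by case: (\sum_(_ <= _ < _) _) => ? ?; case: '[_, _].
have c1 : (fun n => a *+ n) @ \oo --> a.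
  by apply: cvg_trans c; apply: near_eq_cvg; near=> n; rewrite E.
have c2 : (fun n => a *+ n.+1 - a *+ n) @ \oo --> a - a.
  by apply: cvgB => //; rewrite (cvg_shiftS (fun n => a *+ n)).
have c3 : (fun n => a *+ n.+1 - a *+ n) @ \oo --> a.
  apply: (cvg_trans _ (@cvg_cst _ a _ \oo _)).
  apply: near_eq_cvg; near=> n.
  by rewrite mulrS addrK.
have := cvg_unique _ c2 c3; rewrite subrr /scalar_measure => /(_ _).
by rewrite -/a => <-.
Unshelve. all: by end_near. Qed.

HB.instance Definition _ := isMeasure.Build _ _ _ scalar_measure
  scalar_measure0 scalar_measure_ge0 scalar_measure_sigma_additive.

End ScalarMeasure.

Section Integrals.
Context {R : realType} {H : hilbertType R}.
Implicit Types (M : semispectral H) (D : set R) (f : R -> R[i]).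

(* The closed support, i.e. the smallest closed set with M-null complement. *)
Definition msupp M : set R :=
  \bigcap_(C in [set C | closed C /\ M (~` C) = 0]) C.

Definition smeas_L1 M f : Prop :=
  [/\ measurable_fun Rplus (fun x => complex.Re (f x)),
      measurable_fun Rplus (fun x => complex.Im (f x)) &
      forall h, (\int[scalar_measure M h]_(x in Rplus)
                   (complex.Re `|f x|)%:E < +oo)%E].

Definition cintegral (mu : {measure set R -> \bar R}) D f : R[i] :=
  (\int[mu]_(x in D) complex.Re (f x)) +i* (\int[mu]_(x in D) complex.Im (f x)).

(* The bounded operator A with <Ah, h> = \int_D f(x) <M(dx)h, h> for all h;
   it exists and is unique when f is M-integrable over D, 0 being only the
   default value in the other cases. *)
Definition smeas_integral M D f : H -> H :=
  xget 0 [set A | bounded_operator A /\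
                  forall h, '[A h, h] = cintegral (scalar_measure M h) D f].

(* (p(X) - p(1) - p'(1)(X - 1)) / (X - 1)^2, an exact division *)
Definition taylor2_quot (p : {poly R[i]}) : {poly R[i]} :=
  (p - p.[1]%:P - p^`().[1] *: ('X - 1)) %/ ('X - 1) ^+ 2.

Definition associated_semispectral (T : H -> H) M : Prop :=
  compact (msupp M) /\
  forall p : {poly R[i]},
    hereditary p T =
      p.[1] *: idfun - p^`().[1] *: B1 T
      + smeas_integral M Rplus (fun x => (taylor2_quot p).[x%:C]).

End Integrals.

(* Main.v *)
(* If the support of M is {0}, the defining formula for p = X^n reads
   T*^n T^n = I + n D - (1 - 0^n) B with B = M({0}) and D = B - B_1(T); the cases
   n = 1, 2 identify B with B_2(T), and the vanishing second differences at n >= 1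
   amount to T* B_2(T) T = 0. Each condition is a rewriting of this formula.

   (a) On ran T the formula gives |T^n x|^2 = |x|^2 + n d. The linear growth makes
   the Neumann series converge for |z| > 1. If the unit circle were in the
   resolvent set, T - z would be bounded below uniformly on it, and averaging over
   N-th roots of unity would bound \sum_(n < N) |T^n x|^2 by a multiple of
   |x|^2 + |T^N x|^2, which is false for large N.

   (b) A subnormal operator satisfies |T h|^2 <= |T^2 h| |h|; along an orbit this
   forces d = 0, so T is isometric on its range and contractive. Conversely, with
   S = (I - T*T)^(1/2), h |-> (S h, T h, T^2 h, ...) embeds H isometrically into a
   space of sequences on which T extends to "zero plus unitary". *)

Require Import Defs.
From HB Require Import structures.
From mathcomp Require Import all_boot all_order all_algebra.
From mathcomp Require Import all_classical all_reals all_analysis.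
From mathcomp Require Import complex.
From mathcomp Require Import ring lra measurable_realfun cyclic separable cyclotomic.

Set Implicit Arguments.
Unset Strict Implicit.
Unset Printing Implicit Defensive.

Import Order.TTheory GRing.Theory Num.Theory.
Import numFieldNormedType.Exports.

Local Open Scope classical_set_scope.
Local Open Scope ring_scope.
Local Open Scope complex_scope.

(** * Real and complex inner products *)

(** Adjoints and operator integrals are chosen values with a default, so they are usable only once
    existence is proved: Riesz representation serves the adjoint, and concentration at 0 turns each
    integral into an evaluation at 0, where 1 - x^n becomes 1 - 0^n with 0^0 = 1. In (a) the
    spectral radius is a supremum over the spectrum, so a spectral point of modulus exactly 1 has to
    be produced; finite Fourier sums do the work of a contour integral. In (b) T is isometric on its
    range but in general not unitary there. The unitary part is built from backward orbits of the
    adjoint: T* T = I on ran T makes T h, T^2 h, ... such an orbit, and dropping the first entry of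
    a backward orbit is invertible. *)

Section ComplexNumbers.
Context {R : realType}.
Implicit Types (a b z : R[i]) (r : R).

Lemma ReD a b : complex.Re (a + b) = complex.Re a + complex.Re b.
Proof. by case: a b => ? ? []. Qed.

Lemma ReN a : complex.Re (- a) = - complex.Re a.
Proof. by case: a. Qed.

Lemma ReMC r a : complex.Re (r%:C * a) = r * complex.Re a.
Proof. by case: a => ? ?; simpc. Qed.

Lemma ReC_ge0 z : 0 <= complex.Re `|z|.
Proof. by have := normr_ge0 z; rewrite lecE => /andP[]. Qed.

Lemma Re_normE z : (complex.Re `|z|)%:C = `|z|.
Proof. by rewrite RRe_real // ger0_real. Qed.

Lemma Re_normX z n : complex.Re `|z ^+ n| = complex.Re `|z| ^+ n.
Proof. by apply: complexI; rewrite rmorphXn /= !Re_normE normrX. Qed.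

Lemma Re_normV z : complex.Re `|z^-1| = (complex.Re `|z|)^-1.
Proof. by apply: complexI; rewrite fmorphV /= !Re_normE normfV. Qed.

End ComplexNumbers.

Section HilbertBasics.
Context {R : realType} {H : hilbertType R}.
Implicit Types (g h k : H) (a b : R[i]) (r : R).

(** Estimates are done on the real part, where [lra], [nra] and order arguments apply; [innerE]
    recovers the complex product. *)
Definition rip h k : R := complex.Re '[h, k].

Lemma innerC h k : '[h, k] = Num.conj '[k, h].
Proof. by rewrite hermC expr0 mul1r. Qed.

Lemma innerDl g h k : '[g + h, k] = '[g, k] + '[h, k].
Proof. exact: linearDl. Qed.

Lemma innerDr g h k : '[g, h + k] = '[g, h] + '[g, k].
Proof. exact: linearDr. Qed.

Lemma innerZl a h k : '[a *: h, k] = a * '[h, k].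
Proof. exact: linearZl_LR. Qed.

Lemma innerZr a h k : '[h, a *: k] = Num.conj a * '[h, k].
Proof. exact: linearZr_LR. Qed.

Lemma inner0l k : '[0 : H, k] = 0. Proof. exact: linear0l. Qed.

Lemma innerNl h k : '[- h, k] = - '[h, k]. Proof. exact: linearNl. Qed.

Lemma ripC h k : rip h k = rip k h.
Proof. by rewrite /rip innerC; case: '[_, _]. Qed.

Lemma ripDl g h k : rip (g + h) k = rip g k + rip h k.
Proof. by rewrite /rip innerDl ReD. Qed.

Lemma ripDr g h k : rip g (h + k) = rip g h + rip g k.
Proof. by rewrite ripC ripDl !(ripC g). Qed.

Lemma ripZl r h k : rip (r%:C *: h) k = r * rip h k.
Proof. by rewrite /rip innerZl ReMC. Qed.

Lemma ripZr r h k : rip h (r%:C *: k) = r * rip h k.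
Proof. by rewrite ripC ripZl ripC. Qed.

Lemma ripNl h k : rip (- h) k = - rip h k.
Proof. by rewrite /rip innerNl ReN. Qed.

Lemma ripNr h k : rip h (- k) = - rip h k.
Proof. by rewrite ripC ripNl ripC. Qed.

Lemma rip0l k : rip 0 k = 0. Proof. by rewrite /rip inner0l. Qed.
Lemma ripr0 k : rip k 0 = 0. Proof. by rewrite ripC rip0l. Qed.

Lemma ripBl g h k : rip (g - h) k = rip g k - rip h k.
Proof. by rewrite ripDl ripNl. Qed.

Lemma ripBr g h k : rip g (h - k) = rip g h - rip g k.
Proof. by rewrite ripDr ripNr. Qed.

Lemma innerE h k : '[h, k] = rip h k +i* - rip ('i *: h) k.
Proof. by rewrite /rip innerZl; case: '[h, k] => x y; simpc. Qed.

Lemma hnormE h : (hnorm h)%:C = `|h|.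
Proof. by apply: RRe_real; apply: ger0_real. Qed.

Lemma hnorm_ge0 h : 0 <= hnorm h.
Proof. by rewrite -ler0c hnormE. Qed.

Lemma hnormC_sq h : '[h, h] = (hnorm h ^+ 2)%:C.
Proof. by rewrite inner_normE -hnormE rmorphXn. Qed.

Lemma rip_hnorm h : rip h h = hnorm h ^+ 2.
Proof. by rewrite /rip hnormC_sq. Qed.

Lemma hnorm_eq0 h : (hnorm h == 0) = (h == 0).
Proof.
apply/eqP/eqP => [h0|->]; last by rewrite /hnorm normr0.
by apply/normr0_eq0; rewrite -hnormE h0.
Qed.

Lemma hnorm0 : hnorm (0 : H) = 0.
Proof. by apply/eqP; rewrite hnorm_eq0. Qed.

Lemma hnorm_gt0 h : (0 < hnorm h) = (h != 0).
Proof. by rewrite lt_def hnorm_ge0 hnorm_eq0 andbT. Qed.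

Lemma hnormD h k : hnorm (h + k) <= hnorm h + hnorm k.
Proof. by rewrite -lecR rmorphD /= !hnormE ler_normD. Qed.

Lemma hnormN h : hnorm (- h) = hnorm h.
Proof. by rewrite /hnorm normrN. Qed.

Lemma hdistC h k : hnorm (h - k) = hnorm (k - h).
Proof. by rewrite /hnorm distrC. Qed.

Lemma hnormB h k : hnorm (h - k) <= hnorm h + hnorm k.
Proof. by rewrite -(hnormN k) hnormD. Qed.

Lemma hnorm_triB g h k : hnorm (h - k) <= hnorm (h - g) + hnorm (g - k).
Proof. by rewrite (le_trans _ (hnormD _ _)) // addrA subrK. Qed.

Lemma hnormZ a h : hnorm (a *: h) = complex.Re `|a| * hnorm h.
Proof.
by apply: complexI; rewrite rmorphM /= !hnormE normrZ.
Qed.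

Lemma hnormZr r h : 0 <= r -> hnorm (r%:C *: h) = r * hnorm h.
Proof. by move=> r0; rewrite hnormZ ger0_norm // lecR. Qed.

Lemma rip_eq0 h k : (forall g, rip g h = rip g k) -> h = k.
Proof.
move=> E; apply/eqP; rewrite -subr_eq0 -hnorm_eq0 -sqrf_eq0 -rip_hnorm.
by rewrite ripBr E subrr.
Qed.

Lemma hnormD2 h k : hnorm (h + k) ^+ 2 = hnorm h ^+ 2 + 2 * rip h k + hnorm k ^+ 2.
Proof. rewrite -!rip_hnorm ripDl !ripDr (ripC k h); lra. Qed.

Lemma hnormB2 h k : hnorm (h - k) ^+ 2 = hnorm h ^+ 2 - 2 * rip h k + hnorm k ^+ 2.
Proof. rewrite hnormD2 ripNr hnormN; lra. Qed.

Lemma parallelogram h k :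
  hnorm (h + k) ^+ 2 + hnorm (h - k) ^+ 2 = 2 * hnorm h ^+ 2 + 2 * hnorm k ^+ 2.
Proof. rewrite hnormD2 hnormB2; lra. Qed.

Lemma rip_le h k : rip h k <= hnorm h * hnorm k.
Proof.
have [->|h0] := eqVneq h 0; first by rewrite /rip inner0l hnorm0 mul0r.
have p : 0 < hnorm h by rewrite hnorm_gt0.
(* This square equals 2 |h| |k| (|h| |k| - rip h k). *)
have := sqr_ge0 (hnorm ((hnorm k)%:C *: h - (hnorm h)%:C *: k)).
rewrite hnormB2 ripZl ripZr !hnormZr ?hnorm_ge0 //.
have [->|k0] := eqVneq k 0; first by rewrite ripC /rip inner0l hnorm0 mulr0.
have q : 0 < hnorm k by rewrite hnorm_gt0.
have pq : 0 < hnorm h * hnorm k by rewrite mulr_gt0.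
move=> E; rewrite -(ler_pM2l pq); nra.
Qed.

Lemma normr_rip_le h k : `|rip h k| <= hnorm h * hnorm k.
Proof.
rewrite ler_norml rip_le andbT lerNl -ripNl (le_trans (rip_le _ _)) //.
by rewrite hnormN.
Qed.

Lemma positive_inner (A : H -> H) :
  positive_operator A <-> forall h, '[A h, h] = (rip (A h) h)%:C /\ 0 <= rip (A h) h.
Proof.
split=> [pA h|pA h]; last by have [-> ?] := pA h; rewrite ler0c.
have Ah := pA h; split; first by rewrite /rip RRe_real // ger0_real.
by move: Ah; rewrite lecE /= => /andP[].
Qed.

Lemma quadratic_ge0_eq0 (a d : R) : 0 <= a ->
  (forall t, 0 <= t ^+ 2 * a + 2 * t * d) -> d = 0.
Proof.
move=> a0 key.
(* The minimiser is - d / a; dividing by a + 1 instead covers a = 0 and still gives a negative value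
   unless d = 0. *)
have E : (- d / (a + 1)) ^+ 2 * a + 2 * (- d / (a + 1)) * d
    = - (d ^+ 2 * ((a + 2) / (a + 1) ^+ 2)) by field; rewrite gt_eqF // ltr_wpDl.
have := key (- d / (a + 1)); rewrite E oppr_ge0 pmulr_lle0 => [d2|].
  by apply/eqP; rewrite -sqrf_eq0 eq_le d2 sqr_ge0.
by rewrite divr_gt0 ?exprn_gt0 // ltr_wpDl.
Qed.

(** The form is minimal at [h], so its derivative 2 |A h|^2 in the direction [A h] vanishes. This
    turns scalar identities into operator identities such as [B2 T \o T = 0]. *)
Lemma positive_eq0 (A : H -> H) h : linear A ->
  (forall g k, rip (A g) k = rip g (A k)) -> (forall g, 0 <= rip (A g) g) ->
  rip (A h) h = 0 -> A h = 0.
Proof.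
move=> lA sA pA Ah.
have AD x y : A (x + y) = A x + A y by have := lA 1 x y; rewrite !scale1r.
have A0 : A 0 = 0 by apply: (addrI (A 0)); rewrite -AD !addr0.
have AZ a x : A (a *: x) = a *: A x by have := lA a x 0; rewrite !addr0 A0 addr0.
apply/eqP; rewrite -hnorm_eq0 -sqrf_eq0 -rip_hnorm; apply/eqP.
apply: (@quadratic_ge0_eq0 (rip (A (A h)) (A h))) => // t.
have := pA (h + t%:C *: A h).
rewrite AD AZ !(ripDl, ripDr, ripZl, ripZr) Ah add0r.
rewrite (sA (A h) h).
by rewrite (_ : _ + _ = t ^+ 2 * rip (A (A h)) (A h) + 2 * t * rip (A h) (A h)) //; ring.
Qed.

End HilbertBasics.

Section Linear.
Context {R : realType} {H K : hilbertType R}.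
Implicit Types (T : H -> K) (h k : H).

Lemma linearfD T h k : linear T -> T (h + k) = T h + T k.
Proof. by move=> lT; have := lT 1 h k; rewrite !scale1r. Qed.

Lemma linearf0 T : linear T -> T 0 = 0.
Proof. by move=> lT; apply: (addrI (T 0)); rewrite -linearfD // !addr0. Qed.

Lemma linearfZ T a h : linear T -> T (a *: h) = a *: T h.
Proof. by move=> lT; have := lT a h 0; rewrite !addr0 linearf0 // addr0. Qed.

Lemma linearfN T h : linear T -> T (- h) = - T h.
Proof. by move=> lT; rewrite -scaleN1r linearfZ // scaleN1r. Qed.

Lemma linearfB T h k : linear T -> T (h - k) = T h - T k.
Proof. by move=> lT; rewrite linearfD // linearfN. Qed.

Lemma linearf_sum T n (F : nat -> H) : linear T ->
  T (\sum_(i < n) F i) = \sum_(i < n) T (F i).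
Proof.
move=> lT; elim: n => [|n IH]; first by rewrite !big_ord0 linearf0.
by rewrite !big_ord_recr /= linearfD // IH.
Qed.

Lemma bounded_ge0 T : bounded_operator T ->
  exists2 c : R, 0 < c & forall h, hnorm (T h) <= c * hnorm h.
Proof.
move=> [_ [c Tc]]; exists (`|c| + 1) => [|h]; first by rewrite ltr_wpDl.
rewrite (le_trans (Tc h)) // ler_wpM2r ?hnorm_ge0 //.
by rewrite (le_trans (ler_norm c)) // lerDl.
Qed.

End Linear.

Section LinearEndo.
Context {R : realType} {H : hilbertType R}.

(** Complex polarisation: operator integrals are specified only through their quadratic forms, and
    this is what identifies them. *)
Lemma inner_eq_polar (A B : H -> H) : linear A -> linear B ->
  (forall h, '[A h, h] = '[B h, h]) -> A = B.
Proof.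
move=> lA lB E; apply/funext => h.
have P x y : '[A x, y] + '[A y, x] = '[B x, y] + '[B y, x].
  have := E (x + y); rewrite !linearfD // !innerDl !innerDr !E => e.
  apply: (addrI '[B x, x]); apply: (addIr '[B y, y]).
  by rewrite !addrA in e *; exact: e.
apply/rip_eq0 => k; rewrite ripC [RHS]ripC /rip; congr complex.Re.
(* Polarising at [h] and at ['i *: h] separates ['[A h, k]] from ['[A k, h]]. *)
have := P h k; have := P ('i *: h) k; rewrite !linearfZ // !innerZl !innerZr.
set p := '[_, _]; set q := '[_, _]; set r := '[_, _]; set s := '[_, _].
case: p => p1 p2; case: q => q1 q2; case: r => r1 r2; case: s => s1 s2.
simpc => -[e1 e2] [e3 e4]; congr (_ +i* _); lra.
Qed.

Lemma linear_iter (T : H -> H) n : linear T -> linear (iter n T).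
Proof. by move=> lT; elim: n => // n IH a u v /=; rewrite IH lT. Qed.

Lemma opDE (A B : H -> H) h : (A + B) h = A h + B h. Proof. by []. Qed.
Lemma opNE (A : H -> H) h : (- A) h = - A h. Proof. by []. Qed.
Lemma opZE a (A : H -> H) h : (a *: A) h = a *: A h. Proof. by []. Qed.
Lemma op0E h : (0 : H -> H) h = 0. Proof. by []. Qed.
Lemma opMnE (A : H -> H) n h : (A *+ n) h = A h *+ n.
Proof. by elim: n => [|n IH]; rewrite ?mulr0n // !mulrS opDE IH. Qed.
Lemma op_sumE (I : Type) (r : seq I) (P : pred I) (A : I -> H -> H) h :
  (\sum_(i <- r | P i) A i) h = \sum_(i <- r | P i) A i h.
Proof. by elim/big_ind2: _ => // A1 x1 A2 x2 <- <-. Qed.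
Definition opE := (opDE, opNE, opMnE, opZE, op0E, op_sumE).

Lemma ripMnr (h k : H) n : rip h (k *+ n) = rip h k *+ n.
Proof. by elim: n => [|n IH]; rewrite ?mulr0n ?ripr0 // !mulrS ripDr IH. Qed.

Lemma ripMnl (h k : H) n : rip (h *+ n) k = rip h k *+ n.
Proof. by rewrite ripC ripMnr ripC. Qed.

Definition ripE := (@ripDl R H, @ripDr R H, @ripNl R H, @ripNr R H,
  ripMnl, ripMnr, @ripZl R H, @ripZr R H, @rip0l R H, @ripr0 R H).

End LinearEndo.

(** * Completeness, Riesz representation and adjoints *)

Section Completeness.
Context {R : realType} {H : hilbertType R}.
Implicit Types (g h k : H) (u : nat -> H).

Lemma cvg0P (e : nat -> R) : e @ \oo --> (0 : R) <->
  forall d, 0 < d -> exists N, forall n, (N <= n)%N -> `|e n| < d.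
Proof.
split=> [/cvgrPdist_lt E d d0|E].
  have [N _ HN] := E d d0; exists N => n Nn.
  by have := HN n Nn; rewrite /= sub0r normrN.
apply/cvgrPdist_lt => d d0; have [N HN] := E d d0.
by exists N => // n /= Nn; rewrite sub0r normrN; exact: HN.
Qed.

Lemma le_cvg0 (x : R) (e : nat -> R) (N : nat) : e @ \oo --> (0 : R) ->
  (forall n, (N <= n)%N -> x <= e n) -> x <= 0.
Proof.
move=> /cvg0P e0 xe; rewrite leNgt; apply/negP => x0.
have [M HM] := e0 x x0; have := xe (maxn M N) (leq_maxr _ _).
rewrite leNgt => /negP; apply; apply: le_lt_trans (HM _ (leq_maxl _ _)).
exact: ler_norm.
Qed.

Lemma hcvg_of_cvg u l : u @ \oo --> l -> hnorm (u n - l) @[n --> \oo] --> (0 : R).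
Proof.
move=> /cvgrPdist_lt ul; apply/cvg0P => d d0.
have [N _ HN] := ul (d%:C) ltac:(by rewrite ltcR); exists N => n /HN /=.
by rewrite ger0_norm ?hnorm_ge0 // -ltcR hdistC hnormE.
Qed.

(** The rate [e] is kept explicit so that it passes to the limit and can be made uniform over
    vectors in [operator_complete]. *)
Lemma hilbert_complete u (e : nat -> R) : e @ \oo --> (0 : R) ->
  (forall m n, (m <= n)%N -> hnorm (u n - u m) <= e m) ->
  exists l, forall n, hnorm (u n - l) <= e n.
Proof.
move=> e0 ue.
have : cvg (u @ \oo).
  apply/cauchy_cvgP/cauchy_exP => d d0.
  have dR : (complex.Re d)%:C = d by rewrite RRe_real // gtr0_real.
  have d0' : 0 < complex.Re d by rewrite -ltcR dR.
  have /cvg0P/(_ _ d0') [N HN] := e0.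
  exists (u N); exists N => // n /= Nn.
  rewrite -ball_normE /= -dR -hnormE ltcR hdistC.
  by apply: le_lt_trans (HN _ (leqnn N)); rewrite (le_trans (ue _ _ Nn)) // ler_norm.
move=> /cvg_ex[l /hcvg_of_cvg ul]; exists l => n; rewrite -subr_le0.
apply: (le_cvg0 (N := n) ul) => m nm; rewrite lerBlDr.
rewrite (le_trans (hnorm_triB (u m) _ _)) // addrC lerD2l hdistC; exact: ue.
Qed.

Lemma hnorm_lim_eq (h k : H) (e : nat -> R) N : e @ \oo --> (0 : R) ->
  (forall n, (N <= n)%N -> hnorm (h - k) <= e n) -> h = k.
Proof.
move=> e0 E; apply/eqP; rewrite -subr_eq0 -hnorm_eq0 eq_le hnorm_ge0 andbT.
exact: le_cvg0 e0 E.
Qed.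

Lemma operator_complete (S : nat -> H -> H) (e : nat -> R) :
  e @ \oo --> (0 : R) -> (forall n, linear (S n)) ->
  (forall m n h, (m <= n)%N -> hnorm (S n h - S m h) <= e m * hnorm h) ->
  exists2 L : H -> H, linear L & forall n h, hnorm (S n h - L h) <= e n * hnorm h.
Proof.
move=> e0 lS SC.
have eh h : (fun n => e n * hnorm h) @ \oo --> (0 : R).
  by rewrite -(mul0r (hnorm h)); apply: cvgMr_tmp.
have ex h : exists l, forall n, hnorm (S n h - l) <= e n * hnorm h.
  by apply: hilbert_complete (eh h) _ => m n; exact: SC.
have [L HL] := choice ex.
exists L => // a x y.
apply: (@hnorm_lim_eq _ _ (fun n => e n * hnorm (a *: x + y) +
   (complex.Re `|a| * (e n * hnorm x) + e n * hnorm y)) 0).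
  rewrite (_ : 0 = 0 + (complex.Re `|a| * 0 + 0)); last by rewrite mulr0 !addr0.
  by apply: cvgD; [|apply: cvgD; [apply: cvgMl_tmp|]]; exact: eh.
move=> n _; rewrite (le_trans (hnorm_triB (S n (a *: x + y)) _ _)) // lerD //.
  by rewrite hdistC.
rewrite lS opprD addrACA -scalerBr (le_trans (hnormD _ _)) // lerD // hnormZ.
by rewrite ler_wpM2l // ReC_ge0.
Qed.

(* Minimising [|h|^2 - 2 Re f h]: by the parallelogram law minimising sequences
   are Cauchy, and the minimiser represents [f]. *)
Lemma riesz (f : H -> R[i]) (c : R) :
  (forall a h k, f (a *: h + k) = a * f h + f k) ->
  (forall h, complex.Re (f h) <= c * hnorm h) ->
  exists y, forall h, f h = '[h, y].
Proof.
move=> lf fc.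
pose F h := complex.Re (f h).
have fD h k : f (h + k) = f h + f k by have := lf 1 h k; rewrite scale1r mul1r.
have f0 : f 0 = 0 by apply: (addrI (f 0)); rewrite -fD !addr0.
have fZ a h : f (a *: h) = a * f h by have := lf a h 0; rewrite !addr0 f0 addr0.
have FD h k : F (h + k) = F h + F k by rewrite /F fD ReD.
have FZ r h : F (r%:C *: h) = r * F h by rewrite /F fZ ReMC.
(* The imaginary part of [f h] is minus the real part of [f ('i *: h)], so representing the real
   part is enough. *)
suff [y Hy] : exists y, forall h, F h = rip h y.
  exists y => h; rewrite innerE -Hy -Hy /F fZ.
  by case: (f h) => x1 x2; simpc.
pose J h := hnorm h ^+ 2 - 2 * F h.
have Jlb h : - c ^+ 2 <= J h.
  by rewrite /J; have := fc h; rewrite -/(F h); have := sqr_ge0 (hnorm h - c); nra.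
pose A := [set J h | h in [set: H]].
have infA : has_inf A.
  split; first by exists (J 0), 0.
  by exists (- c ^+ 2) => _ [h _ <-].
have Jinf h : inf A <= J h by apply: ge_inf; [case: infA|exists h].
have [u Hu] : {u : nat -> H & forall n, J (u n) < inf A + n.+1%:R^-1}.
  apply: (@choice _ _ (fun n h => J h < inf A + n.+1%:R^-1)) => n.
  have [|_ [h _ <-] Hh] := @inf_adherent R A n.+1%:R^-1 _ infA.
    by rewrite invr_gt0.
  by exists h.
have Jpar h k : hnorm (h - k) ^+ 2 <= 2 * (J h - inf A) + 2 * (J k - inf A).
  have := Jinf (2^-1%:C *: (h + k)).
  rewrite /J FZ FD hnormZr ?invr_ge0 ?ler0n // exprMn.
  have := parallelogram h k; set p := hnorm (h + k) ^+ 2.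
  set q := hnorm (h - k) ^+ 2; lra.
have uC m n : (m <= n)%N -> hnorm (u n - u m) <= 2 * Num.sqrt (m.+1%:R^-1).
  move=> mn; rewrite -(@ler_pXn2r _ 2) ?nnegrE ?hnorm_ge0 ?mulr_ge0 ?sqrtr_ge0 //.
  rewrite exprMn sqr_sqrtr ?invr_ge0 ?ler0n //.
  apply: le_trans (Jpar _ _) _.
  have := Hu m; have := Hu n.
  have : n.+1%:R^-1 <= m.+1%:R^-1 :> R by rewrite lef_pV2 ?posrE ?ltr0n // ler_nat.
  move: (J _) (J _) (inf A) (n.+1%:R^-1) (m.+1%:R^-1) => x y z v w; lra.
have e0 : (fun m => 2 * Num.sqrt (m.+1%:R^-1)) @ \oo --> (0 : R).
  rewrite (_ : 0 = 2 * Num.sqrt 0); last by rewrite sqrtr0 mulr0.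
  apply: cvgMl_tmp.
  apply: (@continuous_cvg _ _ _ _ _ _ Num.sqrt); first exact: sqrt_continuous.
  exact: cvg_harmonic.
have [y Hy] := hilbert_complete e0 uC; exists y => h.
(* First-order optimality, from [J (u n + t h) >= inf A] as [n] tends to infinity. *)
have key (t : R) : 0 <= t ^+ 2 * hnorm h ^+ 2 + 2 * t * (rip h y - F h).
  rewrite -oppr_le0.
  apply: (@le_cvg0 _ (fun n => n.+1%:R^-1 +
     `|2 * t| * (hnorm h * (2 * Num.sqrt (n.+1%:R^-1)))) 0).
    rewrite (_ : 0 = 0 + `|2 * t| * (hnorm h * 0)); last by rewrite !mulr0 addr0.
    by apply: cvgD; [exact: cvg_harmonic|do 2 apply: cvgMl_tmp].
  move=> n _; have := Jinf (u n + t%:C *: h); have := Hu n.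
  rewrite /J FD FZ hnormD2 ripZr hnormZ.
  rewrite exprMn -[complex.Re `|t%:C| ^+ 2]/(complex.Re `|t%:C| * complex.Re `|t%:C|).
  rewrite normc_def /= expr0n addr0 sqrtr_sqr -expr2 real_normK ?num_real //.
  have := rip_le h (u n - y); have := rip_le h (y - u n).
  rewrite (hdistC y) (ripC (u n)) !ripBr => r1 r2.
  have r3 : `|rip h (u n) - rip h y| <= hnorm h * (2 * Num.sqrt (n.+1%:R^-1)).
    apply: (@le_trans _ _ (hnorm h * hnorm (u n - y))).
      by rewrite ler_norml; lra.
    by rewrite ler_wpM2l ?hnorm_ge0.
  have r4 : `|2 * t * (rip h (u n) - rip h y)|
     <= `|2 * t| * (hnorm h * (2 * Num.sqrt (n.+1%:R^-1))).
    by rewrite normrM ler_wpM2l.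
  have := ler_norm (2 * t * (rip h (u n) - rip h y)).
  have := ler_norm (- (2 * t * (rip h (u n) - rip h y))); rewrite normrN.
  move: r4; set P := `|2 * t| * _; set Q := `|_ * (_ - _)|; set W := n.+1%:R^-1.
  lra.
apply/eqP; rewrite eq_sym -subr_eq0; apply/eqP.
exact: quadratic_ge0_eq0 (sqr_ge0 _) key.
Qed.

End Completeness.

Section Adjoint.
Context {R : realType} {H : hilbertType R}.
Implicit Types (T S : H -> H).

(** Riesz representation of h |-> <T h, k> supplies an adjoint, which excludes the default value 0
    of [adjoint]. *)
Lemma adjointP T : bounded_operator T ->
  bounded_operator (adjoint T) /\ is_adjoint T (adjoint T).
Proof.
move=> bT; have [lT _] := bT; have [c c0 Tc] := bounded_ge0 bT.
suff [S HS] : exists S, bounded_operator S /\ is_adjoint T S.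
  by apply: (@xgetPex _ 0 [set S | bounded_operator S /\ is_adjoint T S]); exists S.
have ex k : exists y, forall h, '[T h, k] = '[h, y].
  apply: (@riesz R H _ (c * hnorm k)) => [a x y|h].
    by rewrite linearfD // linearfZ // innerDl innerZl.
  rewrite -/(rip _ _) (le_trans (rip_le _ _)) // mulrAC ler_wpM2r ?hnorm_ge0 //.
have [S HS] := choice ex; exists S; split; last by move=> h k; exact: HS.
split.
  move=> a x y; apply: rip_eq0 => g; rewrite /rip; congr complex.Re.
  by rewrite -HS !innerDr !innerZr !HS.
exists c => k; have [->|Sk] := eqVneq (S k) 0.
  by rewrite hnorm0 mulr_ge0 ?hnorm_ge0 ?ltW.
rewrite -(ler_pM2l (_ : 0 < hnorm (S k))) ?hnorm_gt0 //.
rewrite -expr2 -rip_hnorm {1}/rip -HS (le_trans (rip_le _ _)) //.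
by rewrite mulrCA mulrA ler_wpM2r ?hnorm_ge0 // Tc.
Qed.

Lemma adjoint_unique T S : bounded_operator T -> is_adjoint T S -> adjoint T = S.
Proof.
move=> bT TS; have [_ aT] := adjointP bT; apply/funext => k.
by apply: rip_eq0 => g; rewrite /rip -aT -TS.
Qed.

Lemma rip_adjoint T h k : bounded_operator T -> rip (T h) k = rip h (adjoint T k).
Proof. by move=> /adjointP[_ aT]; rewrite /rip aT. Qed.

Lemma rip_adjointl T h k : bounded_operator T -> rip (adjoint T h) k = rip h (T k).
Proof. by move=> bT; rewrite ripC -rip_adjoint // ripC. Qed.

Lemma is_adjoint_rip (T S : H -> H) : linear T ->
  (forall h k, rip (T h) k = rip h (S k)) -> is_adjoint T S.
Proof.
move=> lT TS h k; rewrite innerE [RHS]innerE -TS; congr (_ +i* - _).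
by rewrite -TS (linearfZ _ _ lT).
Qed.

End Adjoint.

(** * Semispectral measures supported at the origin *)

Section AtomicSupport.
Context {R : realType} {H : hilbertType R}.
Implicit Types (M : semispectral H) (D : set R) (h : H).

Lemma inner_smeas M D h : '[M D h, h] = (fine (scalar_measure M h D))%:C.
Proof. by have /positive_inner/(_ h)[] := smeas_ge0 M D. Qed.

Lemma scalar_measure_fin M h D : scalar_measure M h D = (fine (scalar_measure M h D))%:E.
Proof. by []. Qed.

Lemma smeas_eq0 M D : (forall h, scalar_measure M h D = 0%E) -> M D = 0.
Proof.
move=> E; apply: inner_eq_polar => [||h]; first exact: (smeas_bounded M D).1.
  by move=> a x y /=; rewrite scaler0 addr0.
by rewrite inner_smeas E inner0l.
Qed.

Lemma scalar_measure_eq0 M D h : M D = 0 -> scalar_measure M h D = 0%E.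
Proof. by rewrite /scalar_measure => ->; rewrite inner0l. Qed.

(* R is second countable, so the complement of the support is a countable union
   of null intervals. *)
Lemma msupp_null M h : msupp M = [set 0] -> scalar_measure M h (~` [set 0]) = 0%E.
Proof.
move=> suppM; pose mu : {measure set R -> \bar R} := scalar_measure M h.
pose J (pq : rat * rat) : set R := `]ratr pq.1, ratr pq.2[%classic.
pose F k : set R := if unpickle k is Some pq then
  (if `[< mu (J pq) = 0%E >] then J pq else set0) else set0.
have nF : mu.-negligible (\bigcup_k F k).
  apply: negligible_bigcup => k; rewrite /F; case: unpickle => [pq|].
    case: asboolP => [Jpq|_]; last exact: negligible_set0.
    by exists (J pq); split => //; exact: measurable_itv.
  exact: negligible_set0.
have mD : measurable (~` [set 0] : set R) by apply: measurableC; exact: measurable_set1.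
apply/(measure_negligible mD)/(negligibleS _ nF) => x x0.
have : ~ msupp M x by rewrite suppM.
move=> /existsNP[C] /not_implyP[[cC MC] Cx].
have /nbhs_ballP[e /= e0 eC] : nbhs x (~` C).
  by apply: open_nbhs_nbhs; split => //; exact: closed_openC.
have [p /itvP px] := @rat_in_itvoo R (x - e) x ltac:(by rewrite ltrBlDr ltrDl).
have [q /itvP qx] := @rat_in_itvoo R x (x + e) ltac:(by rewrite ltrDl).
move: (pickle (p, q)) (pickleK (p, q)) => k Ek; exists k => //; rewrite /F Ek.
case: asboolP => [_|[]]; first by rewrite /J /= in_itv /= px qx.
have mJ : measurable (J (p, q)) by exact: measurable_itv.
apply/eqP; rewrite eq_le measure_ge0 andbT.
rewrite -(scalar_measure_eq0 h MC); apply: le_measure; rewrite ?inE //.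
  by apply: open_measurable; exact: closed_openC.
move=> y; rewrite /J /= in_itv /= => /andP[py yq]; apply: eC.
have := px; have := qx; rewrite /ball /= => qx' px'.
have p1 : x - e < ratr p by rewrite px.
have q1 : ratr q < x + e by rewrite qx.
by rewrite ltr_norml; apply/andP; split; lra.
Qed.

Lemma scalar_measure_atom M h D : msupp M = [set 0] -> measurable D -> D 0 ->
  scalar_measure M h D = scalar_measure M h [set 0].
Proof.
move=> suppM mD D0; pose mu : {measure set R -> \bar R} := scalar_measure M h.
rewrite -[LHS]/(mu D) -[RHS]/(mu [set 0]).
have m0 : measurable ([set 0] : set R) by exact: measurable_set1.
have -> : D = [set 0] `|` (D `\ 0).
  by rewrite setUC setUDl setDv setD0 setUidl // => x ->.
rewrite measureU //; last 2 first.
- exact: measurableD.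
- by apply/seteqP; split => x // -[-> [_ /=]].
rewrite -[RHS]adde0; congr (_ + _)%E.
apply/eqP; rewrite eq_le measure_ge0 andbT -(msupp_null h suppM).
by apply: le_measure; rewrite ?inE;
  [exact: measurableD|exact: measurableC|move=> x []].
Qed.

(** The integrand agrees with the constant [f 0] off the null set of nonzero points. *)
Lemma integral_atom M h D (f : R -> R) : msupp M = [set 0] -> measurable D ->
  D 0 -> measurable_fun D f ->
  (\int[scalar_measure M h]_(x in D) (f x)%:E
   = (f 0)%:E * scalar_measure M h [set 0%R])%E.
Proof.
move=> suppM mD D0 mf; rewrite -(scalar_measure_atom h suppM mD D0).
rewrite -integral_cst //.
apply: ae_eq_integral => //; first exact/measurable_EFinP.
exists (~` [set 0]); split; first by apply: measurableC; exact: measurable_set1.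
  exact: msupp_null.
by move=> x /= nE x0; apply: nE; rewrite x0.
Qed.

Lemma Rintegral_atom M h D (f : R -> R) : msupp M = [set 0] -> measurable D ->
  D 0 -> measurable_fun D f ->
  \int[scalar_measure M h]_(x in D) f x = f 0 * fine (scalar_measure M h [set 0]).
Proof. by move=> suppM mD D0 mf; rewrite /Rintegral integral_atom. Qed.

(** [xget] returns some operator with the required quadratic form; polarisation identifies it with
    [f 0 *: M [set 0]]. *)
Lemma smeas_integral_atom M D (f : R -> R[i]) : msupp M = [set 0] ->
  measurable D -> D 0 ->
  measurable_fun D (fun x => complex.Re (f x)) ->
  measurable_fun D (fun x => complex.Im (f x)) ->
  smeas_integral M D f = f 0 *: M [set 0].
Proof.
move=> suppM mD D0 mRe mIm.
pose P := [set A : H -> H | bounded_operator A /\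
  forall h, '[A h, h] = cintegral (scalar_measure M h) D f].
have bM := smeas_bounded M [set 0].
have P0 : P (f 0 *: M [set 0]).
  split=> [|h]; last first.
    rewrite /cintegral !Rintegral_atom // opE innerZl inner_smeas.
    by case: (f 0) => x y; simpc.
  have [c _ Mc] := bounded_ge0 bM; split.
    by move=> a x y; rewrite !opE bM.1 scalerDr !scalerA mulrC.
  exists (complex.Re `|f 0| * c) => h; rewrite opE hnormZ -mulrA ler_wpM2l //.
  exact: ReC_ge0.
have [[lI _] EI] : P (smeas_integral M D f) by apply: (@xgetPex _ 0 P); eexists; exact: P0.
apply: inner_eq_polar => //; first exact: P0.1.1.
by move=> h; rewrite EI P0.2.
Qed.

(** Without mass at 0 the empty set would be closed with null complement, and the support would be
    empty. *)
Lemma smeas_atom_neq0 M : msupp M = [set 0] -> M [set 0] <> 0.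
Proof.
move=> suppM M0; suff : msupp M 0.
  have : msupp M `<=` set0.
    move=> x; apply; split; first exact: closed0.
    rewrite setC0; apply: smeas_eq0 => h.
    by rewrite scalar_measure_atom // scalar_measure_eq0.
  by move=> /[apply].
by rewrite suppM.
Qed.

Section PointMass.
Variables (B : H -> H) (bB : bounded_operator B) (pB : positive_operator B).

Definition point_smeas D : H -> H := if `[< D 0 >] then B else 0.

Lemma point_smeas_bounded D : bounded_operator (point_smeas D).
Proof.
rewrite /point_smeas; case: ifP => // _; split=> [a x y /=|].
  by rewrite scaler0 addr0.
by exists 0 => h; rewrite mul0r hnorm0.
Qed.

Lemma point_smeas_ge0 D : positive_operator (point_smeas D).
Proof. by rewrite /point_smeas; case: ifP => // _ h; rewrite inner0l. Qed.

(** By disjointness at most one [F n] contains 0, so the partial sums are eventually constant. *)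
Lemma point_smeas_sigma_additive (F : nat -> set R) :
  (forall n, measurable (F n)) -> trivIset setT F ->
  forall h k,
    (fun n => \sum_(0 <= i < n) '[point_smeas (F i) h, k] : R[i]^o) @ \oo
      --> ('[point_smeas (\bigcup_n F n) h, k] : R[i]^o).
Proof.
move=> mF tF h k; have [[n _ Fn]|nF] := pselect ((\bigcup_n F n) 0); last first.
  have E i : point_smeas (F i) = 0.
    by rewrite /point_smeas asboolF // => Fi; apply: nF; exists i.
  rewrite {2}/point_smeas asboolF //; apply: cvg_near_cst; apply: nearW => m.
  by rewrite op0E inner0l; apply: big1 => i _; rewrite E op0E inner0l.
apply: cvg_near_cst; exists n.+1 => // m /= nm.
have U : (\bigcup_n F n) 0 by exists n.
rewrite big_mkord (bigD1 (Ordinal nm)) //= big1 ?addr0 => [|i /eqP ni].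
  by rewrite /point_smeas !asboolT.
rewrite /point_smeas asboolF ?inner0l // => Fi; apply: ni; apply/val_inj => /=.
by apply: tF => //; exists 0.
Qed.

Lemma point_smeas_Rplus : point_smeas (~` Rplus) = 0.
Proof. by rewrite /point_smeas asboolF //; apply; rewrite /Rplus /= in_itv /= lexx. Qed.

Definition point_semispectral : semispectral H :=
  Semispectral point_smeas_bounded point_smeas_ge0 point_smeas_sigma_additive
    point_smeas_Rplus.

Lemma point_smeas1 D : D 0 -> point_semispectral D = B.
Proof. by move=> D0; rewrite /= /point_smeas asboolT. Qed.

Lemma point_smeasN D : ~ D 0 -> point_semispectral D = 0.
Proof. by move=> D0; rewrite /= /point_smeas asboolF. Qed.

Lemma msupp_point : B <> 0 -> msupp point_semispectral = [set 0].
Proof.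
move=> B0; apply/seteqP; split=> [x|_ -> C [_ MC]].
  by apply; split; [exact: closed_eq|rewrite point_smeasN //=; apply].
by apply: contrapT => C0; apply: B0; rewrite -(@point_smeas1 (~` C)).
Qed.

End PointMass.

End AtomicSupport.

(** * Measurability of inverses and polynomials *)

Section Measurability.
Context {R : realType}.

Lemma measurable_funV_R (D : set R) (f : R -> R) :
  measurable_fun D f -> measurable_fun D (fun x => (f x)^-1).
Proof.
move=> mf; suff mV : measurable_fun setT (@GRing.inv R) by exact: measurableT_comp mV mf.
have o0 : open [set x : R | x != 0] by exact: open_neq.
rewrite -(setvU ([set x : R | x != 0])); apply/measurable_funU.
- by apply: measurableC; exact: open_measurable.
- exact: open_measurable.
split; last first.
  apply: open_continuous_measurable_fun => //; apply/in_setP => x /= x0.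
  exact: inv_continuous.
rewrite (_ : ~` _ = [set 0]); first exact: measurable_fun_set1.
by apply/seteqP; split => x /= => [/negP/negPn/eqP|->]; rewrite ?eqxx.
Qed.

Lemma measurable_horner (p : {poly R[i]}) (D : set R) :
  measurable_fun D (fun x => complex.Re p.[x%:C]) /\
  measurable_fun D (fun x => complex.Im p.[x%:C]).
Proof.
elim/poly_ind: p => [|p c [mRe mIm]].
  by split; under eq_fun do rewrite horner0; exact: measurable_cst.
split; under eq_fun do rewrite hornerMXaddC.
- rewrite (_ : (fun _ => _) = (fun x => complex.Re p.[x%:C] * x + complex.Re c)).
    by apply: measurable_funD => //; apply: measurable_funM.
  apply/funext => x; case: p.[_] => a b; case: c => u v; simpc => /=.
  by [].
- rewrite (_ : (fun _ => _) = (fun x => complex.Im p.[x%:C] * x + complex.Im c)).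
    by apply: measurable_funD => //; apply: measurable_funM.
  apply/funext => x; case: p.[_] => a b; case: c => u v; simpc => /=.
  by [].
Qed.

End Measurability.

(** * The Taylor quotient at the origin *)

Section Taylor.
Context {R : realType}.

(** The divisor equals 1 at 0, so the quotient takes there the value of the numerator, provided the
    division is exact; it is, since the numerator and its derivative vanish at 1. *)
Lemma taylor2_quot0 (p : {poly R[i]}) :
  (taylor2_quot p).[0] = p.[0] - p.[1] + p^`().[1].
Proof.
rewrite /taylor2_quot; set f := p - _ - _.
have f1 : root f 1.
  by rewrite rootE /f !hornerE !subrr mulr0 subrr.
have [g fg] := factor_theorem f 1 f1.
have g1 : root g 1.
  have : f^`().[1] = 0.
    rewrite /f -polyC1 !derivB derivZ !derivB derivX !derivC !subr0.
    by rewrite !hornerE subrr.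
  by rewrite fg derivM derivB derivX derivC !hornerE !subrr mulr0 add0r subr0 mulr1 => /eqP.
have [q gq] := factor_theorem g 1 g1.
have -> : f = q * ('X - 1) ^+ 2 by rewrite fg gq polyC1 expr2 mulrA.
have X1 : ('X - 1 : {poly R[i]}) ^+ 2 != 0.
  by rewrite expf_neq0 // -polyC1 polyXsubC_eq0.
rewrite mulpK //.
have : f.[0] = q.[0] by rewrite fg gq !hornerE; ring.
move=> <-; rewrite /f !hornerE; ring.
Qed.

End Taylor.

(** * The operators T*^n T^n and the four conditions *)

Section BoundedClosure.
Context {R : realType} {H : hilbertType R}.
Implicit Types (A B T : H -> H).

Lemma bounded_id : bounded_operator (idfun : H -> H).
Proof. by split => //; exists 1 => h; rewrite mul1r. Qed.

Lemma bounded_comp A B : bounded_operator A -> bounded_operator B ->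
  bounded_operator (A \o B).
Proof.
move=> bA bB; have [a a0 Ha] := bounded_ge0 bA; have [b b0 Hb] := bounded_ge0 bB.
split; first by move=> x u v; rewrite /= bB.1 bA.1.
exists (a * b) => h; rewrite (le_trans (Ha _)) // -mulrA ler_wpM2l //; exact: ltW.
Qed.

Lemma boundedD A B : bounded_operator A -> bounded_operator B ->
  bounded_operator (A + B).
Proof.
move=> bA bB; have [a a0 Ha] := bounded_ge0 bA; have [b b0 Hb] := bounded_ge0 bB.
split; first by move=> x u v; rewrite !opE bB.1 bA.1 scalerDr addrACA.
by exists (a + b) => h; rewrite (le_trans (hnormD _ _)) // mulrDl lerD.
Qed.

Lemma boundedN A : bounded_operator A -> bounded_operator (- A).
Proof.
move=> bA; have [a a0 Ha] := bounded_ge0 bA.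
split; first by move=> x u v; rewrite !opE bA.1 opprD scalerN.
by exists a => h; rewrite opE hnormN.
Qed.

Lemma boundedMn A n : bounded_operator A -> bounded_operator (A *+ n).
Proof.
move=> bA; elim: n => [|n IH]; last by rewrite mulrS; exact: boundedD.
rewrite mulr0n; split; first by move=> a x y; rewrite !opE scaler0 addr0.
by exists 0 => h; rewrite opE hnorm0 mul0r.
Qed.

Lemma bounded_iter T n : bounded_operator T -> bounded_operator (iter n T).
Proof.
move=> bT; elim: n => [|n IH]; first exact: bounded_id.
exact: (@bounded_comp T (iter n T)).
Qed.

End BoundedClosure.

Section HereditaryPowers.
Context {R : realType} {H : hilbertType R}.
Variables (T : H -> H) (bT : bounded_operator T).

Lemma rip_hpow n h k : rip (hpow T n h) k = rip (iter n T h) (iter n T k).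
Proof.
rewrite /hpow /=; elim: n (iter n T h) k => // n IH g k.
by rewrite iterS rip_adjointl // IH -iterSr.
Qed.

Lemma bounded_hpow n : bounded_operator (hpow T n).
Proof.
apply: bounded_comp; apply: bounded_iter => //.
by case: (adjointP bT).
Qed.

Lemma bounded_B1 : bounded_operator (B1 T).
Proof.
by apply: boundedD; [exact: bounded_id|apply: boundedN; exact: bounded_hpow].
Qed.

Lemma bounded_B2 : bounded_operator (B2 T).
Proof.
apply: boundedD; last exact: bounded_hpow.
apply: boundedD; first exact: bounded_id.
by apply/boundedN/boundedMn; exact: bounded_hpow.
Qed.

Lemma rip_B1 h k : rip (B1 T h) k = rip h k - rip (T h) (T k).
Proof. by rewrite /B1 !(opE, ripE) rip_hpow. Qed.

Lemma rip_B2 h k :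
  rip (B2 T h) k = rip h k - 2 * rip (T h) (T k) + rip (T (T h)) (T (T k)).
Proof. by rewrite /B2 !(opE, ripE) !rip_hpow /= mulr_natl. Qed.

Lemma hpow_affine_coef (C D : H -> H) :
  (forall n, (1 <= n)%N -> hpow T n = idfun - C + D *+ n) ->
  C = B2 T /\ D = B2 T - B1 T.
Proof.
move=> E; have e1 := E 1%N isT; have e2 := E 2%N isT.
by split; apply/funext => h; apply: rip_eq0 => g; rewrite /B2 /B1 e2 e1 !(opE, ripE) /=; ring.
Qed.

(** The form of [B2 T] at [T h] is the second difference of |T^n h|^2 at n = 1, hence 0; positivity
    upgrades this to [B2 T (T h) = 0]. *)
Lemma B2_comp_eq0 (C D : H -> H) : positive_operator (B2 T) ->
  (forall n, (1 <= n)%N -> hpow T n = idfun - C + D *+ n) -> B2 T \o T = 0.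
Proof.
move=> /positive_inner pB E; apply/funext => h; rewrite [RHS]op0E /=.
apply: positive_eq0 (bounded_B2).1 _ _ _ => [g k|g|].
- by rewrite [RHS]ripC !rip_B2 !(ripC k) !(ripC (T k)) !(ripC (T (T k))).
- by case: (pB g).
- have := rip_hpow 1 h h; have := rip_hpow 2 h h; have := rip_hpow 3 h h.
  by rewrite rip_B2 /= => <- <- <-; rewrite !E // !(opE, ripE); ring.
Qed.

(** The term 0^n spoils the recursion at n = 0; hence the base point 1 and the offset [n.-1]. *)
Lemma second_difference (a : nat -> R) :
  (forall n, (1 <= n)%N -> a n.+2 - 2 * a n.+1 + a n = 0) ->
  forall n, (1 <= n)%N -> a n = a 1%N + n.-1%:R * (a 2%N - a 1%N).
Proof.
move=> E; suff S n : a n.+1 = a 1%N + n%:R * (a 2%N - a 1%N) /\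
    a n.+2 = a 1%N + n.+1%:R * (a 2%N - a 1%N).
  by case=> // n _; case: (S n).
elim: n => [|n [IH1 IH2]]; first by split; ring.
split=> //; have := E n.+1 isT; rewrite IH1 IH2 -(@natr1 R n.+1) -(@natr1 R n).
lra.
Qed.

Lemma hpow_affine n : B2 T \o T = 0 -> (1 <= n)%N ->
  hpow T n = idfun - B2 T + (B2 T - B1 T) *+ n.
Proof.
move=> BT n1; apply/funext => h; apply: rip_eq0 => g.
pose a n := rip (iter n T h) (iter n T g).
have aE m : (1 <= m)%N -> a m = a 1%N + m.-1%:R * (a 2%N - a 1%N).
  apply: second_difference => {n n1 m} [[//|n] _].
  (* The second difference of [a] at [n.+1] is the form of [B2 T] between [iter n.+1 T h] and
     [iter n.+1 T g]; the former lies in the range of T. *)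
  have := congr1 (fun A : H -> H => rip (A (iter n T h)) (iter n.+1 T g)) BT.
  by rewrite /= rip_B2 op0E rip0l /a /= => <-; ring.
rewrite ripC rip_hpow -/(a n) aE //.
move: (rip_B2 h g) (rip_B1 h g); move: (B2 T) (B1 T) => X Y E2 E1.
rewrite !(opE, ripE) !(ripC g) E2 E1.
rewrite /a /=; case: n n1 => // n _; rewrite /= -(mulr_natl _ n.+1) -natr1; ring.
Qed.

(* All the conditions say [hpow T n = I + n D - (1 - 0^n) B], and then
   [B = B2 T] and [D = B2 T - B1 T]; [0 ^ 0 = 1] accounts for [n = 0]. *)
Lemma hpow_affine0 (B D : H -> H) :
  (forall n, (1 <= n)%N -> hpow T n = idfun - B + D *+ n) ->
  forall n, hpow T n = idfun + D *+ n - (1 - 0 ^+ n) *: B.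
Proof.
move=> E [|n]; first by rewrite mulr0n expr0 subrr scale0r subr0 addr0.
by rewrite E // expr0n /= subr0 scale1r addrAC.
Qed.

(** Against coefficients of sum 0 the affine part contributes nothing, and 0^(i + j) = 0^i 0^j
    leaves c |l_0|^2. *)
Lemma CPD_affine (B D : H -> H) : positive_operator B ->
  (forall n, hpow T n = idfun + D *+ n - (1 - 0 ^+ n) *: B) -> CPD T.
Proof.
move=> /positive_inner pB E h k l l0.
set c := rip (B h) h; have c0 : 0 <= c by case: (pB h).
set d := rip (D h) h; pose a := hnorm h ^+ 2 - c.
have gE n : hnorm (iter n T h) ^+ 2 = a + n%:R * d + 0 ^+ n * c.
  rewrite -rip_hnorm -rip_hpow E !(opE, ripE) rip_hnorm.
  rewrite (_ : 1 - 0 ^+ n = (1 - 0 ^+ n : R)%:C); last by rewrite rmorphB rmorphXn.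
  by rewrite ripZl -/c -/d /a -mulr_natl; ring.
have toC m n : (a + (m + n)%:R * d + 0 ^+ (m + n) * c)%:C
    = a%:C + (m%:R + n%:R) * d%:C + 0 ^+ (m + n) * c%:C :> R[i].
  clearbody a; rewrite rmorphD rmorphD rmorphM rmorph_nat natrD rmorphM rmorphXn.
  by rewrite rmorph0.
have l0' : \sum_i Num.conj (l i) = 0 by rewrite -rmorph_sum l0 rmorph0.
(* This is [l 0], written as a sum so that the product with its conjugate expands into a double
   sum. *)
pose z := \sum_(i < k.+1) 0 ^+ i * l i.
rewrite (_ : \sum_(i < _) _ = c%:C * (z * Num.conj z)).
  by rewrite mulr_ge0 ?ler0c // -normCK exprn_ge0.
have zE : z * Num.conj z = \sum_(i < k.+1) \sum_(j < k.+1) 0 ^+ (i + j) * l i * Num.conj (l j).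
  rewrite rmorph_sum mulr_suml; apply: eq_bigr => i _; rewrite mulr_sumr.
  apply: eq_bigr => j _; rewrite rmorphM rmorphXn rmorph0 exprD; ring.
(* The weight a + (i + j) d splits into a + i d, killed by the sum over j, and j d, killed by the
   sum over i. *)
transitivity (\sum_(i < k.+1) ((a%:C + i%:R * d%:C) * l i) * \sum_(j < k.+1) Num.conj (l j) +
  (\sum_(i < k.+1) l i) * (\sum_(j < k.+1) j%:R * d%:C * Num.conj (l j)) + c%:C * (z * Num.conj z)); last first.
  rewrite l0 mul0r addr0 big1 ?add0r // => i _; by rewrite l0' mulr0.
rewrite zE mulr_suml mulr_sumr -!big_split /=; apply: eq_bigr => i _.
rewrite !mulr_sumr -!big_split /=; apply: eq_bigr => j _.
rewrite gE toC; ring.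
Qed.

(** The sequences 1, n and 0^n are the values at X^n of the functionals p(1), p'(1) and p(0). *)
Lemma hereditary_affine (B D : H -> H) (p : {poly R[i]}) :
  (forall n, hpow T n = idfun + D *+ n - (1 - 0 ^+ n) *: B) ->
  hereditary p T = p.[1] *: idfun + p^`().[1] *: D - (p.[1] - p.[0]) *: B.
Proof.
move=> E; rewrite /hereditary.
have p1 : p.[1] = \sum_(i < size p) p`_i.
  by rewrite horner_coef; apply: eq_bigr => i _; rewrite expr1n mulr1.
have p10 : p.[1] - p.[0] = \sum_(i < size p) p`_i * (1 - 0 ^+ i).
  rewrite p1 horner_coef -sumrB; apply: eq_bigr => i _; ring.
have dp1 : p^`().[1] = \sum_(i < size p) p`_i *+ i.
  rewrite -{1}(coefK p) poly_def linear_sum /= horner_sum; apply: eq_bigr => i _.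
  by rewrite derivZ derivXn hornerZ hornerMn hornerXn expr1n mulr_natr.
rewrite p10 p1 dp1 !scaler_suml -big_split /= -sumrB.
apply: eq_bigr => i _; by rewrite E scalerBr scalerDr -scalerMnr scalerMnl scalerA.
Qed.

End HereditaryPowers.

(** * Passing between the measure and the affine formula *)

Section Equivalences.
Context {R : realType} {H : hilbertType R}.
Variables (T : H -> H) (bT : bounded_operator T).

Lemma Rplus0 : (Rplus : set R) 0.
Proof. by rewrite /Rplus /= in_itv /= lexx. Qed.

Lemma smeas_integral_taylor (M : semispectral H) (p : {poly R[i]}) :
  msupp M = [set 0] ->
  smeas_integral M Rplus (fun x => (taylor2_quot p).[x%:C])
  = (p.[0] - p.[1] + p^`().[1]) *: M [set 0].
Proof.
move=> suppM; have [mRe mIm] := measurable_horner (taylor2_quot p) Rplus.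
rewrite smeas_integral_atom ?taylor2_quot0 //; first exact: measurable_itv.
exact: Rplus0.
Qed.

Lemma associated_affine (M : semispectral H) :
  associated_semispectral T M -> msupp M = [set 0] ->
  forall n, (1 <= n)%N ->
    hpow T n = idfun - M [set 0] + (M [set 0] - B1 T) *+ n.
Proof.
move=> [_ assoc] suppM n n1; have := assoc 'X^n.
have -> : hereditary 'X^n T = hpow T n.
  rewrite /hereditary size_polyXn big_ord_recr /= big1 ?add0r => [|i _].
    by rewrite coefXn eqxx scale1r.
  by rewrite coefXn ltn_eqF // scale0r.
(* For n >= 1 the Taylor quotient of X^n has the value 0 - 1 + n at 0. *)
rewrite smeas_integral_taylor // derivXn hornerMn !hornerXn expr0n gtn_eqF //.
rewrite !expr1n sub0r scale1r scaler_nat => ->.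
apply/funext => h; apply: rip_eq0 => g.
rewrite (_ : -1 + n%:R = (-1 + n%:R : R)%:C); last by rewrite rmorphD rmorphN rmorph1 rmorph_nat.
move: (B1 T) (M [set 0]) => X Y; rewrite !(opE, ripE); ring.
Qed.

Lemma smeas_integral_powers (F : semispectral H) n : msupp F = [set 0] ->
  smeas_integral F `[0, 1[ (fun x => ((1 - x ^+ n) / (1 - x) ^+ 2)%:C)
  = (1 - 0 ^+ n) *: F [set 0].
Proof.
move=> suppF; rewrite smeas_integral_atom //.
- by rewrite subr0 expr1n divr1 rmorphB rmorphXn rmorph0.
- by rewrite /= in_itv /= lexx ltr01.
- apply: measurable_funM; last apply: measurable_funV_R; last apply: measurable_funX.
    by apply: measurable_funB => //; apply: measurable_funX.
  exact: measurable_funB.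
Qed.

Lemma smeas_L1_atom (F : semispectral H) (f : R -> R) : msupp F = [set 0] ->
  measurable_fun Rplus f -> smeas_L1 F (fun x => (f x)%:C).
Proof.
move=> suppF mf; split=> // h.
rewrite integral_atom //; [|exact: measurable_itv|exact: Rplus0|].
  by rewrite scalar_measure_fin -EFinM ltry.
rewrite (_ : (fun _ => _) = (fun x => `|f x|)); first exact: measurableT_comp.
by apply/funext => x; rewrite normc_def /= expr0n addr0 sqrtr_sqr.
Qed.

Lemma i_to_affine : CPD T /\ (exists2 M : semispectral H,
    associated_semispectral T M & msupp M = [set 0]) ->
  exists2 C : H -> H, positive_operator C /\ C <> 0 &
    exists D, forall n, (1 <= n)%N -> hpow T n = idfun - C + D *+ n.
Proof.
move=> [_ [M assoc suppM]]; exists (M [set 0]).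
  by split; [exact: smeas_ge0|exact: smeas_atom_neq0].
by exists (M [set 0] - B1 T); exact: associated_affine.
Qed.

Lemma affine_to_ii (C D : H -> H) : positive_operator C -> C <> 0 ->
  (forall n, (1 <= n)%N -> hpow T n = idfun - C + D *+ n) ->
  [/\ B2 T \o T = 0, positive_operator (B2 T) & B2 T <> 0].
Proof.
move=> pC C0 E; have [eC _] := hpow_affine_coef E.
by split; [apply: (B2_comp_eq0 bT) E|..]; rewrite -eC.
Qed.

Lemma iii_to_iv : positive_operator (B2 T) -> B2 T <> 0 ->
  (forall n, (1 <= n)%N -> hpow T n = idfun - B2 T + (B2 T - B1 T) *+ n) ->
  exists (F : semispectral H) (D : H -> H),
    [/\ msupp F = [set 0],
        bounded_operator D /\ selfadjoint D,
        F `[1, +oo[%classic = 0,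
        smeas_L1 F (fun x => (1 / (1 - x))%:C) &
        forall n : nat,
          hpow T n = idfun + D *+ n
            - smeas_integral F `[0, 1[
                (fun x => ((1 - x ^+ n) / (1 - x) ^+ 2)%:C)].
Proof.
move=> pB B0 E; have bB := bounded_B2 bT.
exists (point_semispectral bB pB), (B2 T - B1 T).
have suppF := msupp_point bB pB B0; split => //.
- have bD : bounded_operator (B2 T - B1 T).
    by apply: boundedD => //; apply: boundedN; exact: bounded_B1.
  split=> //; apply: adjoint_unique => //; apply: is_adjoint_rip bD.1 _ => x y.
  move: (rip_B2 bT x y) (rip_B2 bT y x) (rip_B1 bT x y) (rip_B1 bT y x).
  move: (B2 T) (B1 T) => X Y; rewrite !(opE, ripE) (ripC x (X y)) (ripC x (Y y)).
  by rewrite (ripC y) (ripC (T y)) (ripC (T (T y))) => -> -> -> ->.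
- by apply: point_smeasN; rewrite /= in_itv /= ler10.
(* At x = 1 the inverse takes the default value 0, which keeps the integrand measurable on all of
   [Rplus]. *)
- apply: smeas_L1_atom => //; apply: measurable_funM => //.
  by apply: measurable_funV_R; exact: measurable_funB.
move=> n; rewrite smeas_integral_powers // point_smeas1 //.
exact: hpow_affine0.
Qed.

Lemma iv_to_i (F : semispectral H) (D : H -> H) : msupp F = [set 0] ->
  (forall n : nat, hpow T n = idfun + D *+ n
     - smeas_integral F `[0, 1[ (fun x => ((1 - x ^+ n) / (1 - x) ^+ 2)%:C)) ->
  CPD T /\ (exists2 M : semispectral H,
               associated_semispectral T M & msupp M = [set 0]).
Proof.
move=> suppF; set C := F [set 0] => E.
have {}E n : hpow T n = idfun + D *+ n - (1 - 0 ^+ n) *: C.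
  by rewrite E smeas_integral_powers.
split; first exact: CPD_affine bT _ _ (smeas_ge0 F [set 0]) E.
exists F => //; split; first by rewrite suppF; exact: compact_set1.
move=> p; rewrite smeas_integral_taylor // (hereditary_affine p E) -/C.
have [eC eD] : C = B2 T /\ D = B2 T - B1 T.
  apply: hpow_affine_coef => n n1.
  by rewrite E expr0n gtn_eqF // subr0 scale1r addrAC.
have -> : D = C - B1 T by rewrite eC.
(* With D = C - B1 T, the terms in C add up to p(0) - p(1) + p'(1), the Taylor quotient at 0. *)
rewrite scalerBr -!addrA; congr (_ + _).
rewrite addrCA; congr (_ + _).
by rewrite -scaleNr -scalerDl; congr (_ *: _); ring.
Qed.

End Equivalences.

(** * The spectral radius *)

Section Neumann.
Context {R : realType} {H : hilbertType R}.
Variables (T : H -> H) (bT : bounded_operator T).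
Implicit Types (z : R[i]) (h : H).

Lemma neumann z (K q : R) : z != 0 -> 0 <= K -> 0 <= q < 1 ->
  (forall n h, hnorm (iter n T h) <= K * q ^+ n * complex.Re `|z| ^+ n * hnorm h) ->
  ~ spectrum T z.
Proof.
move=> z0 K0 /andP[q0 q1] TK; apply; have [lT _] := bT.
have [c c0 Tc] := bounded_ge0 bT.
set s := complex.Re `|z| in TK; have s0 : 0 < s.
  by rewrite /s -ltcR Re_normE normr_gt0.
pose S n h := \sum_(k < n) z ^- k.+1 *: iter k T h.
have lS n : linear (S n).
  move=> a x y; rewrite /S scaler_sumr -big_split; apply: eq_bigr => k _.
  by rewrite (linear_iter _ lT) scalerDr !scalerA mulrC.
have Sr n h : S n.+1 h = S n h + z ^- n.+1 *: iter n T h by rewrite /S big_ord_recr.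
have nz n h : hnorm (z ^- n *: iter n T h) <= K * q ^+ n * hnorm h.
  rewrite hnormZ Re_normV Re_normX -/s mulrC ler_pdivrMr ?exprn_gt0 //.
  by rewrite mulrAC TK.
(* The tail of the geometric majorant; [e m - e n] is exactly its sum over indices from m to n -
   1. *)
pose e n := K / s / (1 - q) * q ^+ n.
have q1' : 0 < 1 - q by rewrite subr_gt0.
have SC m n h : (m <= n)%N -> hnorm (S n h - S m h) <= e m * hnorm h.
  move=> mn; apply: (@le_trans _ _ ((e m - e n) * hnorm h)); last first.
    by rewrite ler_wpM2r ?hnorm_ge0 // gerBl /e !mulr_ge0 ?exprn_ge0 ?invr_ge0 // ltW.
  elim: n mn => [|n IH]; first by rewrite leqn0 => /eqP ->; rewrite !subrr hnorm0 mul0r.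
  rewrite leq_eqVlt => /predU1P[->|]; first by rewrite !subrr hnorm0 mul0r.
  rewrite ltnS => /IH {}IH; rewrite Sr addrAC (le_trans (hnormD _ _)) //.
  have -> : (e m - e n.+1) * hnorm h =
    (e m - e n) * hnorm h + s^-1 * (K * q ^+ n * hnorm h).
    by rewrite /e exprSr; field; rewrite !gt_eqF.
  rewrite lerD // exprSr invfM mulrC -scalerA hnormZ Re_normV.
  by apply: ler_wpM2l (nz n h); rewrite invr_ge0 ltW.
have e0 : e @ \oo --> (0 : R).
  rewrite -(mulr0 (K / s / (1 - q))); apply: cvgMl_tmp.
  by apply: cvg_expr; rewrite ger0_norm.
have [L lL SL] := operator_complete e0 lS SC.
(* The series telescopes; since the remainder z^(-n) T^n h tends to 0, the inverse of T - z is
   [- L]. *)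
have TS n h : T (S n h) - z *: S n h = z ^- n *: iter n T h - h.
  elim: n => [|n IH].
    by rewrite /S !big_ord0 linearf0 // scaler0 invr1 scale1r /= !subrr.
  rewrite Sr linearfD // linearfZ // scalerDr opprD addrACA IH scalerA.
  have -> : z * z ^- n.+1 = z ^- n by rewrite exprS invfM mulrA divff // mul1r.
  by rewrite addrC addrA subrK.
have SiT n h : S n (T h) = T (S n h).
  rewrite /S (linearf_sum n (fun k => z ^- k.+1 *: iter k T h) lT); apply: eq_bigr => k _; rewrite linearfZ //.
  by rewrite -iterSr.
have qn0 h : (fun n => K * q ^+ n * hnorm h) @ \oo --> (0 : R).
  rewrite -(mul0r (hnorm h)) -(mulr0 K); apply: cvgMr_tmp; apply: cvgMl_tmp.
  by apply: cvg_expr; rewrite ger0_norm.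
have en0 h : (fun n => e n * hnorm h) @ \oo --> (0 : R).
  by rewrite -(mul0r (hnorm h)); apply: cvgMr_tmp.
exists (- L); split.
- split; first by move=> a x y; rewrite !opE lL opprD scalerN.
  exists (e 0%N) => h; rewrite opE hnormN.
  by have := SL 0%N h; rewrite /S big_ord0 sub0r hnormN.
- apply/funext => h; rewrite /= !opE -[idfun h]/h.
  apply/eqP; rewrite eqr_oppLR; apply/eqP.
  apply: (@hnorm_lim_eq _ _ _ _ (fun n => e n * hnorm (T h - z *: h) + K * q ^+ n * hnorm h) 0).
    by rewrite -(addr0 0); apply: cvgD.
  move=> n _; rewrite (le_trans (hnorm_triB (S n (T h - z *: h)) _ _)) // lerD //.
    by rewrite hdistC SL.
  rewrite (linearfB _ _ (lS n)) (linearfZ _ _ (lS n)) SiT TS opprK subrK; exact: nz.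
- apply/funext => h; rewrite /= !opE -[idfun _]/(- L h).
  rewrite (linearfN _ lT) scalerN opprK addrC -opprB -[RHS]opprK; congr (- _).
  apply: (@hnorm_lim_eq _ _ _ _ (fun n => (c + s) * (e n * hnorm h) + K * q ^+ n * hnorm h) 0).
    rewrite -(addr0 0) -{1}(mulr0 (c + s)); apply: cvgD => //; exact: cvgMl_tmp.
  move=> n _; rewrite (le_trans (hnorm_triB (T (S n h) - z *: S n h) _ _)) // lerD //.
    rewrite hdistC opprB (addrC (z *: L h)) addrACA (addrC (- (z *: S n h))) -linearfB // -scalerBr mulrDl.
    rewrite (le_trans (hnormD _ _)) // lerD //.
      by rewrite (le_trans (Tc _)) // ler_pM2l // SL.
    by rewrite hnormZ hdistC ler_pM2l // SL.
  by rewrite TS opprK subrK nz.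
Qed.

(** Bernoulli's inequality bounds n by r^n / (r - 1), and the extra 1 by r^n. *)
Lemma natr_le_geometric (r : R) : 1 < r ->
  exists2 K : R, 0 <= K & forall n, n.+1%:R <= K * r ^+ n.
Proof.
move=> r1; have d0 : 0 < r - 1 by rewrite subr_gt0.
have B n : 1 + n%:R * (r - 1) <= r ^+ n.
  elim: n => [|n IH]; first by rewrite expr0 mul0r addr0.
  rewrite exprS -natr1; have n0 : 0 <= n%:R :> R by [].
  have : r * (1 + n%:R * (r - 1)) <= r * r ^+ n by rewrite ler_pM2l //; lra.
  apply: le_trans; have : 0 <= n%:R * (r - 1) ^+ 2 by rewrite mulr_ge0 ?sqr_ge0.
  lra.
exists (1 + (r - 1)^-1) => [|n]; first by rewrite addr_ge0 ?invr_ge0 ?ltW.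
have := B n; have := ler0n R n; rewrite -natr1; set x := n%:R; set y := r ^+ n.
move=> x0 xy; have y1 : 1 <= y by rewrite (le_trans _ xy) // lerDl mulr_ge0 // ltW.
have : x <= (r - 1)^-1 * y by rewrite ler_pdivlMl //; lra.
lra.
Qed.

Lemma spectrum_linear_growth (c : R) : 0 <= c ->
  (forall n h, hnorm (iter n T h) ^+ 2 <= c * n.+1%:R * hnorm h ^+ 2) ->
  forall z, spectrum T z -> complex.Re `|z| <= 1.
Proof.
move=> c0 Tc z; apply: contraPP => /negP; rewrite -ltNge => z1.
(* Any r strictly between 1 and |z| works: r^n absorbs the growth and r / s is the Neumann ratio. *)
set s := complex.Re `|z| in z1; pose r := (1 + s) / 2.
have r1 : 1 < r by rewrite /r; lra.
have rs : r < s by rewrite /r; lra.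
have s0 : 0 < s by lra.
have [K K0 HK] := natr_le_geometric r1.
apply: (@neumann z ((c + 1) * K) (r / s)).
- by rewrite -normr_gt0 -Re_normE ltcR.
- by rewrite mulr_ge0 // addr_ge0.
- by rewrite divr_ge0 ?ltr_pdivrMr ?mul1r //=; lra.
move=> n h; rewrite -/s -(mulrA _ _ (s ^+ n)) -exprMn divfK ?gt_eqF //.
rewrite -(@ler_pXn2r _ 2) ?nnegrE ?hnorm_ge0 //; last first.
  by rewrite !mulr_ge0 ?hnorm_ge0 ?exprn_ge0 ?addr_ge0 //; lra.
rewrite (le_trans (Tc n h)) // exprMn ler_wpM2r ?sqr_ge0 //.
have n1 : 1 <= n.+1%:R :> R by rewrite ler1n.
have := HK n; set x := n.+1%:R in n1 *; set y := r ^+ n => xy.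
(* As x >= 1, c x <= ((c + 1) x)^2; squaring the linear factor avoids the square root of n + 1. *)
apply: (@le_trans _ _ (((c + 1) * x) ^+ 2)); first by nra.
rewrite ler_pXn2r ?nnegrE -?mulrA ?ler_wpM2l ?mulr_ge0 ?exprn_ge0 ?addr_ge0 //.
lra.
Qed.

End Neumann.

(** * Roots of unity and a discrete Parseval identity *)

Section RootsOfUnity.
Context {R : realType}.

(** X^n - 1 splits and is separable in characteristic 0; among n distinct n-th roots of unity one is
    primitive. *)
Lemma prim_root_complex n : (0 < n)%N -> exists w : R[i], n.-primitive_root w.
Proof.
pose p : {poly R[i]} := 'X^n - 1; have [r Dp] := closed_field_poly_normal p.
move=> n_gt0; rewrite (monicP _) ?monicXnsubC // scale1r in Dp.
have rn1 : all n.-unity_root r by apply/allP => z; rewrite -root_prod_XsubC -Dp.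
have sz_r : (n < (size r).+1)%N.
  by rewrite -(size_prod_XsubC r id) -Dp size_XnsubC.
have [|z] := hasP (has_prim_root n_gt0 rn1 _ sz_r); last by exists z.
by rewrite -separable_prod_XsubC -Dp separable_Xn_sub_1 // pnatr_eq0 -lt0n.
Qed.

Lemma unity_root_norm n (w : R[i]) : (0 < n)%N -> w ^+ n = 1 -> `|w| = 1.
Proof.
by move=> n0 wn; apply/eqP; rewrite -(@pexpr_eq1 _ _ n) // -normrX wn normr1.
Qed.

Lemma unity_root_sum n (w : R[i]) : w ^+ n = 1 -> w != 1 ->
  \sum_(j < n) w ^+ j = 0.
Proof.
move=> wn w1; apply/eqP; have := subrX1 w n; rewrite wn subrr => /esym/eqP.
by rewrite mulf_eq0 subr_eq0 (negPf w1).
Qed.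

Context {H : hilbertType R}.

Lemma inner_suml (I : Type) (r : seq I) (P : pred I) (F : I -> H) (k : H) :
  '[\sum_(i <- r | P i) F i, k] = \sum_(i <- r | P i) '[F i, k].
Proof.
elim/big_ind2: _ => // [|x1 x2 y1 y2 <- <-]; by rewrite ?inner0l ?innerDl.
Qed.

Lemma inner_sumr (I : Type) (r : seq I) (P : pred I) (F : I -> H) (k : H) :
  '[k, \sum_(i <- r | P i) F i] = \sum_(i <- r | P i) '[k, F i].
Proof.
rewrite innerC inner_suml rmorph_sum; by apply: eq_bigr => i _; rewrite [RHS]innerC.
Qed.

(** The vector-valued discrete Fourier transform: orthogonality of the characters j |-> w^(j k)
    removes the off-diagonal terms. *)
Lemma parseval n (w : R[i]) (v : 'I_n -> H) : n.-primitive_root w ->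
  \sum_(j < n) hnorm (\sum_(k < n) (w ^+ j) ^+ k *: v k) ^+ 2
  = n%:R * \sum_(k < n) hnorm (v k) ^+ 2.
Proof.
move=> pw; have n0 := prim_order_gt0 pw; have wn := prim_expr_order pw.
have w0 : w != 0.
  apply/eqP => w0; have := oner_neq0 R[i].
  by rewrite -wn w0 expr0n gtn_eqF // eqxx.
have wJ : Num.conj w = w^-1.
  by rewrite invC_norm (unity_root_norm n0 wn) expr1n invr1 mul1r.
apply: complexI; rewrite rmorph_sum rmorphM rmorph_nat rmorph_sum /=.
under eq_bigr do rewrite -hnormC_sq inner_suml.
under [in RHS]eq_bigr do rewrite -hnormC_sq.
rewrite exchange_big mulr_sumr; apply: eq_bigr => k _ /=.
under eq_bigr do rewrite inner_sumr.
rewrite exchange_big (bigD1 k) //= [X in _ + X]big1 ?addr0 => [|l lk].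
  under eq_bigr => j _.
    rewrite innerZl innerZr mulrA !rmorphXn /= wJ -!exprM -exprMn divff // expr1n mul1r.
    over.
  by rewrite sumr_const card_ord mulr_natl.
transitivity ((\sum_(j < n) (w ^+ k / w ^+ l) ^+ j) * '[v k, v l]).
  rewrite mulr_suml; apply: eq_bigr => j _.
  by rewrite innerZl innerZr mulrA !rmorphXn /= wJ exprMn !exprVn -!exprM !(mulnC j).
rewrite unity_root_sum ?mul0r //.
  by rewrite exprMn exprVn -!exprM !(mulnC _ n) !exprM wn !expr1n divr1.
rewrite -subr_eq0 -(mulfV (_ : w ^+ l != 0)) ?expf_neq0 // -mulrBl mulf_neq0 //.
  by rewrite subr_eq0 (eq_prim_root_expr pw) !modn_small // eq_sym.
by rewrite invr_neq0 ?expf_neq0.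
Qed.

End RootsOfUnity.

(** * A spectral point on the unit circle *)

Section UnitCircle.
Context {R : realType} {H : hilbertType R}.
Variables (T : H -> H) (bT : bounded_operator T).

Lemma circle_bounded_below :
  (forall z : R[i], `|z| = 1 -> ~ spectrum T z) ->
  exists2 C : R, 0 <= C & forall z : R[i], `|z| = 1 ->
    forall h, hnorm h <= C * hnorm (T h - z *: h).
Proof.
move=> nsp.
have loc (z : R[i]) : `|z| = 1 -> exists2 c : R, 0 < c &
    forall h, hnorm h <= c * hnorm (T h - z *: h).
  move=> /nsp /contrapT[S [bS ST _]]; have [c c0 Sc] := bounded_ge0 bS.
  by exists c => // h; rewrite -{1}[h]/(idfun h) -ST /= (le_trans (Sc _)) // !opE.
(* The circle is viewed in [R * R], as a closed subset of the compact square [-1, 1]^2. *)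
pose f (p : R * R) : R := p.1 ^+ 2 + p.2 ^+ 2.
have fn (p : R * R) : f p = 1 <-> `|p.1 +i* p.2| = 1.
  rewrite normc_def /= -/(f p); split=> [->|]; first by rewrite sqrtr1.
  move=> /complexI/(congr1 (fun x => x ^+ 2)); rewrite sqr_sqrtr ?expr1n //.
  by rewrite addr_ge0 ?sqr_ge0.
pose K := f @^-1` [set 1].
have cK : compact K.
  apply: (@subclosed_compact _ K (`[-1, 1]%classic `*` `[-1, 1]%classic)).
  - apply: preimage_closed; last exact: closed_eq.
    move=> p _; apply: cvgD; apply: cvgM.
    + exact: cvg_fst.
    + exact: cvg_fst.
    + exact: cvg_snd.
    + exact: cvg_snd.
  - by apply: compact_setX; exact: segment_compact.
  - move=> [a b]; rewrite /K /f /= => ab; split; rewrite /= in_itv /=.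
      by apply/andP; split; have := sqr_ge0 b; nra.
    by apply/andP; split; have := sqr_ge0 a; nra.
pose P (C : R) (p : R * R) := forall h, hnorm h <= C * hnorm (T h - (p.1 +i* p.2) *: h).
have /compact_near_coveringP/(_ R (pinfty_nbhs R) P _) := cK.
case; last first.
  move=> M [Mr HM]; exists (`|M| + 1) => [|[a b] z1 h]; first by rewrite addr_ge0.
  have -> : a +i* b = (a, b).1 +i* (a, b).2 by [].
  apply: HM; first by rewrite (le_lt_trans (ler_norm M)) // ltrDl.
  exact/fn.
(* Within this distance in each coordinate, T - p changes by at most 2 d |h| = |h| / (2 c). Half of
   |h| is thus absorbed, and the local constant c becomes 2 c. *)
move=> p /fn/loc[c c0 Hc]; pose d := (4 * c)^-1.
have d0 : 0 < d by rewrite invr_gt0 mulr_gt0.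
exists ([set p' : R * R | ball p.1 d p'.1 /\ ball p.2 d p'.2], [set C | 2 * c < C]).
  split; last by exists (2 * c); split => //; exact: num_real.
  by exists (ball p.1 d, ball p.2 d); [split; exact: nbhsx_ballx|move=> [? ?] []].
move=> [[a b] C] /= [[pa pb] cC] h.
have Cge : hnorm (T h - (p.1 +i* p.2) *: h) <=
    hnorm (T h - (a +i* b) *: h) + (d + d) * hnorm h.
  have -> : T h - (p.1 +i* p.2) *: h
     = (T h - (a +i* b) *: h) + ((a +i* b) - (p.1 +i* p.2)) *: h.
    by rewrite scalerBl addrA subrK.
  rewrite (le_trans (hnormD _ _)) // lerD2l hnormZ ler_wpM2r ?hnorm_ge0 //.
  have -> : (a +i* b) - (p.1 +i* p.2) = (a - p.1)%:C + (b - p.2)%:C * 'i by simpc.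
  rewrite -lecR Re_normE (le_trans (ler_normD _ _)) // normrM.
  have -> : `|'i : R[i]| = 1 by rewrite normc_def /= expr0n expr1n add0r sqrtr1.
  have nC (x : R) : `|x%:C| = `|x|%:C :> R[i] by rewrite normc_def /= expr0n addr0 sqrtr_sqr.
  rewrite mulr1 !nC -rmorphD lecR; move: pa pb; rewrite /ball /= => pa pb.
  by rewrite !(distrC _ p.1, distrC _ p.2) lerD // ltW.
have := Hc h; have h0 := hnorm_ge0 h.
move: Cge; set x := hnorm (T h - _); set y := hnorm (T h - _) => xy hx.
have y0 : 0 <= y by exact: hnorm_ge0.
have cd : c * (d + d) = 2^-1 by rewrite /d; field; rewrite gt_eqF.
have : hnorm h <= c * y + 2^-1 * hnorm h.
  by rewrite -cd -mulrA -mulrDr (le_trans hx) // ler_pM2l.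
have : 2 * c * y <= C * y by rewrite ler_wpM2r // ltW.
lra.
Qed.

(* With [z ^ N = 1] and [u z = \sum_(k < N) z ^ k T ^ (N - 1 - k) x] one has
   [(T - z) u z = T ^ N x - x]; if [T - z] were bounded below uniformly on the
   unit circle, averaging [|u z| ^ 2] over the [N]-th roots of unity would bound
   [\sum_(n < N) |T ^ n x| ^ 2] by a multiple of [|x| ^ 2 + |T ^ N x| ^ 2]. *)
Lemma unit_circle_spectrum (x : H) (d : R) : x != 0 ->
  (forall n, hnorm (iter n T x) ^+ 2 = hnorm x ^+ 2 + n%:R * d) ->
  exists2 z : R[i], `|z| = 1 & spectrum T z.
Proof.
move=> x0 Tx; apply: contrapT => nex.
have [|C C0 HC] := circle_bounded_below.
  by move=> z z1 sz; apply: nex; exists z.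
set a := hnorm x ^+ 2 in Tx; have a0 : 0 < a by rewrite exprn_gt0 // hnorm_gt0.
have [lT _] := bT.
(* For d < 0 the squared norms would eventually be negative. *)
have d0 : 0 <= d.
  rewrite leNgt; apply/negP => dn.
  have [n Hn] : exists n, a / - d < n%:R.
    exists (Num.bound (a / - d)); apply: archi_boundP.
    by rewrite divr_ge0 ?ltW // oppr_gt0.
  have := Tx n; have := sqr_ge0 (hnorm (iter n T x)).
  move: Hn; rewrite ltr_pdivrMr ?oppr_gt0 //; lra.
(* Parseval will give N a + N (N - 1) d / 2 <= C^2 (4 a + 2 N d); this fails as soon as N - 1 > 4
   C^2, because a > 0 and d >= 0. *)
pose N := (Num.bound (4 * C ^+ 2)).+1.
have NC : 4 * C ^+ 2 < N.-1%:R by rewrite /N /=; apply: archi_boundP; rewrite mulr_ge0 ?sqr_ge0.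
have [w pw] : exists w : R[i], N.-primitive_root w by exact: prim_root_complex.
pose v (k : 'I_N) := iter (N.-1 - k) T x.
pose u (z : R[i]) := \sum_(k < N) z ^+ k *: v k.
have uE (z : R[i]) m : T (\sum_(k < m.+1) z ^+ k *: iter (m - k) T x)
    - z *: (\sum_(k < m.+1) z ^+ k *: iter (m - k) T x) = iter m.+1 T x - z ^+ m.+1 *: x.
  elim: m => [|m IH]; first by rewrite !big_ord_recr !big_ord0 /= !add0r !scale1r expr1.
  have -> : \sum_(k < m.+2) z ^+ k *: iter (m.+1 - k) T x
     = T (\sum_(k < m.+1) z ^+ k *: iter (m - k) T x) + z ^+ m.+1 *: x.
    rewrite big_ord_recr subnn /= (linearf_sum _ (fun k => z ^+ k *: iter (m - k) T x) lT).
    congr (_ + _); apply: eq_bigr => k _.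
    by rewrite (linearfZ _ _ lT) subSn ?leq_ord.
  rewrite (linearfD _ _ lT) scalerDr opprD addrACA -(linearfZ z _ lT) -linearfB // IH.
  by rewrite linearfB // addrA subrK scalerA -exprS.
have ub (j : 'I_N) : hnorm (u (w ^+ j)) ^+ 2 <= C ^+ 2 * (4 * a + 2 * (N%:R * d)).
  have z1 : (w ^+ j) ^+ N = 1 by rewrite exprAC (prim_expr_order pw) expr1n.
  have := HC _ (unity_root_norm (prim_order_gt0 pw) z1) (u (w ^+ j)).
  have -> : T (u (w ^+ j)) - w ^+ j *: u (w ^+ j) = iter N T x - x.
    by have := uE (w ^+ j) N.-1; rewrite -[N.-1.+1]/N z1 scale1r.
  move=> uC; have p0 : 0 <= hnorm (iter N T x - x) by exact: hnorm_ge0.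
  (* By the parallelogram law the left side is at most 2 |T^N x|^2 + 2 |x|^2. *)
  have : hnorm (iter N T x - x) ^+ 2 <= 4 * a + 2 * (N%:R * d).
    have := Tx N; have := parallelogram (iter N T x) x; rewrite -/a.
    have := sqr_ge0 (hnorm (iter N T x + x)); lra.
  move=> p2; apply: (@le_trans _ _ ((C * hnorm (iter N T x - x)) ^+ 2)).
    by rewrite ler_pXn2r ?nnegrE ?hnorm_ge0 ?mulr_ge0.
  by rewrite exprMn ler_wpM2l ?sqr_ge0.
have := parseval v pw.
have vE m : \sum_(k < m) (a + (m.-1 - k)%:R * d) = m%:R * a + m%:R * m.-1%:R / 2 * d.
  rewrite (reindex_inj rev_ord_inj) /=.
  transitivity (\sum_(k < m) (a + k%:R * d)).
    apply: eq_bigr => k _; congr (_ + _%:R * d).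
    by case: m k => [[]//|m] k /=; rewrite subSS subKn // leq_ord.
  elim: m => [|m IH]; first by rewrite big_ord0; ring.
  rewrite big_ord_recr /= IH; case: m {IH} => [|m]; first by rewrite /=; ring.
  by rewrite /= -!natr1; field.
have -> : \sum_(k < N) hnorm (v k) ^+ 2 = N%:R * a + N%:R * N.-1%:R / 2 * d.
  by rewrite -vE; apply: eq_bigr => k _; rewrite /v Tx.
move=> E; have := ler_sum (P := xpredT) (index_enum 'I_N) (fun j _ => ub j).
rewrite E sumr_const card_ord -[leRHS]mulr_natl.
have N0 : 0 < N%:R :> R by rewrite ltr0n.
rewrite ler_pM2l //.
move: NC; set c := C ^+ 2; have c0 : 0 <= c by exact: sqr_ge0.
have NN : N.-1%:R <= N%:R :> R by rewrite ler_nat leq_pred.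
set n := N%:R in N0 NN *; set m := N.-1%:R in NN * => NC.
have h1 : 4 * c * a < n * a by rewrite ltr_pM2r //; lra.
have h2 : 4 * c * (n * d) <= m * (n * d).
  by rewrite ler_wpM2r ?mulr_ge0 //; lra.
lra.
Qed.

End UnitCircle.

(** * Consequences of subnormality *)

Section OperatorNorm.
Context {R : realType} {H : hilbertType R}.
Variables (T : H -> H) (bT : bounded_operator T).

Lemma opnorm_has_sup : has_sup [set hnorm (T h) | h in [set h | hnorm h <= 1]].
Proof.
have [c c0 Tc] := bounded_ge0 bT; split.
  by exists (hnorm (T 0)), 0 => //=; rewrite hnorm0.
exists c => _ [h /= h1 <-]; rewrite (le_trans (Tc h)) // -[leRHS]mulr1.
by rewrite ler_pM2l.
Qed.

Lemma opnorm_le1P : opnorm T <= 1 <-> forall h, hnorm (T h) <= hnorm h.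
Proof.
split=> [T1 h|Th]; last first.
  apply: ge_sup; first by case: opnorm_has_sup.
  by move=> _ [h /= h1 <-]; exact: le_trans (Th h) h1.
have [->|h0] := eqVneq h 0; first by rewrite (linearf0 bT.1).
have p : 0 < hnorm h by rewrite hnorm_gt0.
rewrite -(ler_pM2l (_ : 0 < (hnorm h)^-1)) ?invr_gt0 // mulVf ?gt_eqF //.
rewrite -hnormZr ?invr_ge0 ?hnorm_ge0 // -(linearfZ _ _ bT.1) (le_trans _ T1) //.
apply: ub_le_sup; first by case: opnorm_has_sup.
by exists ((hnorm h)^-1%:C *: h) => //=; rewrite hnormZr ?invr_ge0 ?hnorm_ge0 // mulVf ?gt_eqF.
Qed.

Lemma opnorm_eq1 x : (forall h, hnorm (T h) <= hnorm h) -> x != 0 ->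
  hnorm (T x) = hnorm x -> opnorm T = 1.
Proof.
move=> Th x0 Tx; have p : 0 < hnorm x by rewrite hnorm_gt0.
apply/eqP; rewrite eq_le (opnorm_le1P.2 Th) /=.
apply: ub_le_sup; first by case: opnorm_has_sup.
have V0 : 0 <= (hnorm x)^-1 by rewrite invr_ge0 hnorm_ge0.
exists ((hnorm x)^-1%:C *: x) => /=; first by rewrite hnormZr // mulVf ?gt_eqF.
by rewrite (linearfZ _ _ bT.1) hnormZr // Tx mulVf ?gt_eqF.
Qed.

End OperatorNorm.

(** * Orbit growth, spectral radius and subnormality *)

Section Consequences.
Context {R : realType} {H : hilbertType R}.
Variables (T : H -> H) (bT : bounded_operator T) (BT : B2 T \o T = 0).

(** The orbit starts at [T h] because T*^n T^n is affine in n only from n = 1 on. *)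
Lemma orbit_affine h : exists d : R, forall n,
  hnorm (iter n T (T h)) ^+ 2 = hnorm (T h) ^+ 2 + n%:R * d.
Proof.
exists (rip ((B2 T - B1 T) h) h) => n.
have E m : hnorm (iter m T (T h)) ^+ 2
    = rip ((idfun - B2 T) h) h + m.+1%:R * rip ((B2 T - B1 T) h) h.
  rewrite -iterSr -rip_hnorm -(rip_hpow bT) (hpow_affine bT BT) //.
  move: (B2 T - B1 T) (idfun - B2 T) => X Y.
  by rewrite opDE opMnE ripDl ripMnl mulr_natl.
by rewrite E; have /= -> := E 0%N; rewrite -natr1; ring.
Qed.

Lemma rip_bounded (A : H -> H) : bounded_operator A ->
  exists2 c : R, 0 <= c & forall h, rip (A h) h <= c * hnorm h ^+ 2.
Proof.
move=> /bounded_ge0[c c0 Ac]; exists c; first exact: ltW.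
by move=> h; rewrite (le_trans (rip_le _ _)) // expr2 mulrA ler_wpM2r ?hnorm_ge0.
Qed.

Lemma orbit_linear_growth : exists2 c : R, 0 <= c & forall n h,
  hnorm (iter n T h) ^+ 2 <= c * n.+1%:R * hnorm h ^+ 2.
Proof.
have bB1 := bounded_B1 bT; have bB2 := bounded_B2 bT.
have [a a0 Ha] := rip_bounded (boundedD (@bounded_id R H) (boundedN bB2)).
have [b b0 Hb] := rip_bounded (boundedD bB2 (boundedN bB1)).
(* 1 serves n = 0, [a] bounds the constant part I - B2, and [b] bounds the increment B2 - B1. *)
exists (1 + a + b) => [|[|n] h]; first by rewrite !addr_ge0.
  by rewrite mulr1 /= ler_peMl ?sqr_ge0 // -addrA lerDl addr_ge0.
rewrite -rip_hnorm -(rip_hpow bT) (hpow_affine bT BT) //.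
move: (B2 T - B1 T) (idfun - B2 T) Ha Hb => X Y Ha Hb.
rewrite opDE opMnE ripDl ripMnl -[rip _ _ *+ _]mulr_natl.
have n0 : 0 <= n%:R :> R by [].
have := Ha h; have := Hb h; have := sqr_ge0 (hnorm h); rewrite -!natr1.
set x := hnorm h ^+ 2; set y := rip _ _; set z := rip _ _; set m := n%:R in n0 *.
move=> x0 yb za; have : (m + 1) * y <= (m + 1) * (b * x).
  by rewrite ler_wpM2l // addr_ge0.
have : 0 <= m * (a * x) by rewrite !mulr_ge0 ?hnorm_ge0.
have : 0 <= a * x by rewrite !mulr_ge0 ?hnorm_ge0.
have : 0 <= b * x by rewrite !mulr_ge0 ?hnorm_ge0.
have : 0 <= m * x by rewrite !mulr_ge0 ?hnorm_ge0.
lra.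
Qed.

Lemma spectral_radius_eq1 : T <> 0 -> spectral_radius T = 1.
Proof.
move=> T0; have [h Th] : exists h, T h != 0.
  apply: contrapT => nE; apply: T0; apply/funext => h; apply/eqP.
  by apply: contrapT => /negP Th; apply: nE; exists h.
have [c c0 Hc] := orbit_linear_growth.
have ubS : ubound [set complex.Re `|z| | z in spectrum T] 1.
  by move=> _ [z sz <-]; exact: spectrum_linear_growth c0 Hc z sz.
have [d Hd] := orbit_affine h.
have [z z1 sz] := unit_circle_spectrum bT Th Hd.
have S1 : [set complex.Re `|z| | z in spectrum T] 1 by exists z => //; rewrite z1.
apply/eqP; rewrite eq_le; apply/andP; split.
  by apply: ge_sup ubS; exists 1.
by apply: ub_le_sup => //; exists 1.
Qed.

Lemma normal_norm (K : hilbertType R) (N : K -> K) k : bounded_operator N ->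
  normal_operator N -> hnorm (adjoint N k) = hnorm (N k).
Proof.
move=> bN nN; apply/eqP; rewrite -(@eqrXn2 _ 2) ?hnorm_ge0 //.
rewrite -!rip_hnorm rip_adjointl // (rip_adjoint k (N k) bN).
by have /= -> := congr1 (fun f : K -> K => f k) nN.
Qed.

(** In the larger space |N v|^2 = <N* N v, v> <= |N* N v| |v|, and normality replaces |N* N v| by |N
    N v|. *)
Lemma subnormal_paranormal h : subnormal T ->
  hnorm (T h) ^+ 2 <= hnorm (T (T h)) * hnorm h.
Proof.
move=> [K [V [N [lV iV bN nN VT]]]].
have hV g : hnorm (V g) = hnorm g by rewrite /hnorm iV.
rewrite -!hV !VT -rip_hnorm -rip_adjointl // (le_trans (rip_le _ _)) //.
by rewrite normal_norm.
Qed.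

Lemma subnormal_isometric_range h : subnormal T ->
  hnorm (T (T h)) = hnorm (T h).
Proof.
move=> sT; have [d Hd] := orbit_affine h.
have := subnormal_paranormal (T h) sT; have /= := Hd 1%N; have /= := Hd 2%N.
have := hnorm_ge0 (T h); have := hnorm_ge0 (T (T h)); have := hnorm_ge0 (T (T (T h))).
set x := hnorm (T h); set y := hnorm (T (T h)); set z := hnorm (T (T (T h))) => z0 y0 x0 zE yE yxz.
(* Here y^2 = x^2 + d and z^2 = x^2 + 2 d, so squaring y^2 <= z x leaves d^2 <= 0. *)
have d0 : d ^+ 2 <= 0.
  have : (y ^+ 2) ^+ 2 <= (z * x) ^+ 2 by rewrite ler_pXn2r ?nnegrE ?mulr_ge0 ?sqr_ge0.
  rewrite (exprMn _ z x) zE yE; lra.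
have /eqP dE : d == 0 by rewrite -sqrf_eq0 eq_le d0 sqr_ge0.
by apply/eqP; rewrite -(@eqrXn2 _ 2) // yE dE; apply/eqP; ring.
Qed.

Lemma subnormal_contraction h : subnormal T -> hnorm (T h) <= hnorm h.
Proof.
move=> sT; have := subnormal_paranormal h sT.
rewrite subnormal_isometric_range //; have [->|Th] := eqVneq (T h) 0.
  by rewrite hnorm0 hnorm_ge0.
by rewrite expr2 ler_pM2l // hnorm_gt0.
Qed.

(** Contractivity makes the form of [B1 T] nonnegative, and isometry on the range makes it vanish at
    [T h]; [positive_eq0] concludes. *)
Lemma subnormal_B1 : subnormal T -> B1 T \o T = 0 /\ opnorm T <= 1.
Proof.
move=> sT; split; last by apply/(opnorm_le1P bT) => h; exact: subnormal_contraction.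
apply/funext => h; rewrite [RHS]op0E /=.
apply: positive_eq0 (bounded_B1 bT).1 _ _ _ => [g k|g|].
- by rewrite [RHS]ripC !rip_B1 // (ripC k) (ripC (T k)).
- rewrite rip_B1 // !rip_hnorm subr_ge0 ler_pXn2r ?nnegrE ?hnorm_ge0 //.
  exact: subnormal_contraction.
- by rewrite rip_B1 // !rip_hnorm subnormal_isometric_range // subrr.
Qed.

Lemma subnormal_opnorm : subnormal T -> T <> 0 -> opnorm T = 1.
Proof.
move=> sT T0; have [h Th] : exists h, T h != 0.
  apply: contrapT => nE; apply: T0; apply/funext => h; apply/eqP.
  by apply: contrapT => /negP Th; apply: nE; exists h.
apply: (opnorm_eq1 bT _ Th); first by move=> g; exact: subnormal_contraction.
exact: subnormal_isometric_range.
Qed.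

End Consequences.

(** * Square root of I - T*T *)

Section DefectRoot.
Context {R : realType} {H : hilbertType R}.
Variables (T : H -> H) (bT : bounded_operator T).
Hypothesis cT : forall h, hnorm (T h) <= hnorm h.

Let P := hpow T 1.

(* [root_approx n] converges to [Y] with [2 Y = P + Y ^ 2], so [(I - Y) ^ 2 = I - P]. *)
Fixpoint root_approx (n : nat) (h : H) : H :=
  if n is m.+1 then (2^-1 : R)%:C *: (P h + root_approx m (root_approx m h)) else 0.

(** The same recursion with P replaced by its norm bound 1. It majorises the approximants and their
    increments, which reduces convergence to that of a bounded monotone real sequence. *)
Fixpoint root_bound (n : nat) : R :=
  if n is m.+1 then 2^-1 * (1 + root_bound m ^+ 2) else 0.

Let Y := root_approx.
Let a := root_bound.

Let V2_ge0 : 0 <= (2^-1 : R). Proof. by rewrite invr_ge0. Qed.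

Lemma norm_hpow1 h : hnorm (P h) <= hnorm h.
Proof.
have [->|Ph] := eqVneq (P h) 0; first by rewrite hnorm0 hnorm_ge0.
rewrite -(ler_pM2r (_ : 0 < hnorm (P h))) ?hnorm_gt0 // -expr2 -rip_hnorm.
rewrite /P rip_hpow // (le_trans (rip_le _ _)) // ler_pM ?hnorm_ge0 //; exact: cT.
Qed.

Lemma linear_root_approx n : linear (Y n).
Proof.
elim: n => [|n IH] x u v; first by rewrite /= scaler0 addr0.
rewrite /Y /= -/(Y n) !IH /P (bounded_hpow bT 1).1 addrACA.
by rewrite -[x *: _ + x *: _]scalerDr [LHS]scalerDr !scalerA mulrC.
Qed.

Lemma root_bound_01 n : 0 <= a n <= 1.
Proof.
elim: n => [|n /andP[a0 a1]]; first by rewrite /a /= lexx ler01.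
by rewrite /a /= -/(a n); apply/andP; split; nra.
Qed.

Lemma root_bound_le n : a n <= a n.+1.
Proof. by have /andP[a0 a1] := root_bound_01 n; rewrite /a /= -/(a n); nra. Qed.

Lemma root_approx_le n h : hnorm (Y n h) <= a n * hnorm h.
Proof.
elim: n h => [|n IH] h; first by rewrite /Y /a /= hnorm0 mul0r.
have /andP[a0 _] := root_bound_01 n.
rewrite /Y /a /= -/(Y n) -/(a n) hnormZr // -mulrA ler_pM2l ?invr_gt0 //.
rewrite (le_trans (hnormD _ _)) // mulrDl mul1r lerD ?norm_hpow1 //.
by rewrite (le_trans (IH _)) // expr2 -mulrA ler_wpM2l.
Qed.

(* [Y_(n+1)^2 - Y_n^2 = Y_(n+1) (Y_(n+1) - Y_n) + (Y_(n+1) - Y_n) Y_n] *)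
Lemma root_approx_step n h : hnorm (Y n.+1 h - Y n h) <= (a n.+1 - a n) * hnorm h.
Proof.
elim: n h => [|n IH] h.
  rewrite /Y /a /= subr0 addr0 hnormZr // expr0n addr0 subr0 mulr1.
  by rewrite ler_pM2l ?invr_gt0 ?norm_hpow1.
have /andP[a0 _] := root_bound_01 n; have /andP[b0 _] := root_bound_01 n.+1.
have ab := root_bound_le n.
have -> : Y n.+2 h - Y n.+1 h =
    (2^-1 : R)%:C *: (Y n.+1 (Y n.+1 h - Y n h) + (Y n.+1 (Y n h) - Y n (Y n h))).
  rewrite (linearfB _ _ (linear_root_approx n.+1)) addrA subrK.
  transitivity ((2^-1 : R)%:C *: (P h + Y n.+1 (Y n.+1 h))
     - (2^-1 : R)%:C *: (P h + Y n (Y n h))); first by [].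
  by rewrite -scalerBr opprD addrACA subrr add0r.
have -> : (a n.+2 - a n.+1) * hnorm h =
    2^-1 * (a n.+1 * ((a n.+1 - a n) * hnorm h) + (a n.+1 - a n) * (a n * hnorm h)).
  transitivity ((2^-1 * (1 + a n.+1 ^+ 2) - 2^-1 * (1 + a n ^+ 2)) * hnorm h);
    [by []|ring].
rewrite hnormZr // ler_pM2l ?invr_gt0 // (le_trans (hnormD _ _)) // lerD //.
  by rewrite (le_trans (root_approx_le _ _)) // ler_wpM2l.
by rewrite (le_trans (IH _)) // ler_wpM2l ?subr_ge0 // root_approx_le.
Qed.

(** For the limit L, symmetry and 2 L = P + L^2 give |h - L h|^2 = |h|^2 - <P h, h>. *)
Lemma defect_root : exists S : H -> H, linear S /\
  forall h, hnorm (S h) ^+ 2 = hnorm h ^+ 2 - hnorm (T h) ^+ 2.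
Proof.
have a_mono : nondecreasing_seq a by apply/nondecreasing_seqP => n; exact: root_bound_le.
have a_ub : has_ubound (range a).
  by exists 1 => _ [n _ <-]; case/andP: (root_bound_01 n).
have a_cvg := nondecreasing_cvgn a_mono a_ub.
set l := sup _ in a_cvg.
have al n : a n <= l by apply: ub_le_sup => //; exists n.
pose e n := l - a n.
have e0 : e @ \oo --> (0 : R) by rewrite -(subrr l); apply: cvgB => //; exact: cvg_cst.
have YC m n h : (m <= n)%N -> hnorm (Y n h - Y m h) <= e m * hnorm h.
  move=> mn; apply: (@le_trans _ _ ((a n - a m) * hnorm h)); last first.
    by rewrite ler_wpM2r ?hnorm_ge0 // lerB.
  elim: n mn => [|n IH]; first by rewrite leqn0 => /eqP ->; rewrite !subrr hnorm0 mul0r.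
  rewrite leq_eqVlt => /predU1P[->|]; first by rewrite !subrr hnorm0 mul0r.
  rewrite ltnS => /IH {}IH; rewrite (le_trans (hnorm_triB (Y n h) _ _)) //.
  rewrite (_ : (a n.+1 - a m) * hnorm h =
    (a n.+1 - a n) * hnorm h + (a n - a m) * hnorm h); last by ring.
  by rewrite lerD // root_approx_step.
have [L lL YL] := operator_complete e0 linear_root_approx YC.
have symY n h k : rip (Y n h) k = rip h (Y n k).
  elim: n h k => [|n IH] h k; first by rewrite /Y /= rip0l ripr0.
  rewrite /Y /= -/(Y n) ripZl ripZr ripDl ripDr !IH; congr (_ * (_ + _)).
  by rewrite /P rip_hpow // ripC [RHS]ripC rip_hpow.
have symL h k : rip (L h) k = rip h (L k).
  apply/eqP; rewrite -subr_eq0 -normr_eq0 eq_le normr_ge0 andbT.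
  apply: (@le_cvg0 _ _ (fun n => e n * (2 * (hnorm h * hnorm k))) 0).
    by rewrite -(mul0r (2 * (hnorm h * hnorm k))); apply: cvgMr_tmp.
  move=> n _.
  have -> : rip (L h) k - rip h (L k) = rip (L h - Y n h) k - rip h (L k - Y n k).
    by rewrite ripBl ripBr symY; ring.
  rewrite (le_trans (ler_normB _ _)) //.
  have : `|rip (L h - Y n h) k| <= e n * hnorm h * hnorm k.
    by rewrite (le_trans (normr_rip_le _ _)) // ler_wpM2r ?hnorm_ge0 // hdistC YL.
  have : `|rip h (L k - Y n k)| <= hnorm h * (e n * hnorm k).
    by rewrite (le_trans (normr_rip_le _ _)) // ler_wpM2l ?hnorm_ge0 // hdistC YL.
  lra.
have LE h : L h *+ 2 = P h + L (L h).
  rewrite -scaler_nat.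
  apply: (@hnorm_lim_eq _ _ _ _ (fun n => 2 * (e n.+1 * hnorm h) +
    (e n * hnorm h + e n * hnorm (L h))) 0).
    have ev0 x : (fun n => e n * x) @ \oo --> (0 : R).
      by rewrite -(mul0r x); apply: cvgMr_tmp.
    rewrite (_ : 0 = 2 * 0 + (0 + 0)); last by rewrite mulr0 !addr0.
    apply: cvgD.
      by apply: cvgMl_tmp; rewrite (cvg_shiftS (fun n => e n * hnorm h)).
    by apply: cvgD.
  move=> n _; rewrite (le_trans (hnorm_triB (2%:R *: Y n.+1 h) _ _)) // lerD //.
    rewrite -scalerBr (_ : 2 = (2 : R)%:C); last by rewrite rmorph_nat.
    by rewrite hnormZr // hdistC ler_pM2l.
  have -> : 2%:R *: Y n.+1 h = P h + Y n (Y n h).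
    rewrite /Y /= -/(Y n) scalerA (_ : 2 = (2 : R)%:C); last by rewrite rmorph_nat.
    by rewrite -rmorphM mulfV // rmorph1 scale1r.
  rewrite opprD addrACA subrr add0r (le_trans (hnorm_triB (Y n (L h)) _ _)) // lerD //.
  rewrite -(linearfB _ _ (linear_root_approx n)) (le_trans (root_approx_le _ _)) //.
  have /andP[a0 a1] := root_bound_01 n.
  by rewrite (le_trans _ (YL n h)) // ler_piMl ?hnorm_ge0.
exists (fun h => h - L h); split=> [x u v|h].
  by rewrite lL opprD addrACA scalerBr.
have := congr1 (fun x => rip x h) (LE h); rewrite ripMnl ripDl /P rip_hpow // (symL (L h) h).
rewrite hnormB2 -!rip_hnorm (ripC h) /= mulr2n; lra.
Qed.

End DefectRoot.

(** * A space of backward orbits *)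

(** Bundled so that the type [orbit_space A] depends on [A] alone and can carry the Hilbert
    structure. *)
Record contraction (R : realType) (H : hilbertType R) := Contraction {
  cfun :> H -> H;
  contraction_linear : linear cfun;
  contraction_le : forall h, hnorm (cfun h) <= hnorm h
}.

Section BackwardOrbits.
Context {R : realType} {H : hilbertType R}.
Variable A : contraction H.

(* Model for normal extensions of the form "zero plus unitary": a vector is a
   sequence [y] with a free entry [y 0] and a bounded backward orbit
   [y 1, y 2, ...] of [A]. On backward orbits the shift is unitary for the norm
   [lim |y n|], with inverse given by [A]. *)
Definition backward : {pred (nat -> H)} := fun y =>
  `[< (forall n, A (y n.+2) = y n.+1) /\ exists c : R, forall n, hnorm (y n) <= c >].

Lemma backwardP (y : nat -> H) : reflect
  ((forall n, A (y n.+2) = y n.+1) /\ exists c : R, forall n, hnorm (y n) <= c)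
  (y \in backward).
Proof. exact: asboolP. Qed.

Lemma backward_submod_closed : submod_closed backward.
Proof.
have lA := contraction_linear A.
split.
  apply/backwardP; split=> [n|]; first exact: linearf0.
  by exists 0 => n; rewrite hnorm0.
move=> a y z /backwardP[Ay [c yc]] /backwardP[Az [d zd]]; apply/backwardP; split.
  by move=> n; rewrite -[LHS]/(A (a *: y n.+2 + z n.+2)) lA Ay Az.
exists (complex.Re `|a| * c + d) => n; rewrite -[(a *: y + z) n]/(a *: y n + z n).
by rewrite (le_trans (hnormD _ _)) // hnormZ lerD // ler_wpM2l // ReC_ge0.
Qed.

HB.instance Definition _ := GRing.isSubmodClosed.Build R[i] (nat -> H) backward
  backward_submod_closed.

Record orbit_space := OrbitSpace { orbit :> nat -> H ; orbitP : orbit \in backward }.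

HB.instance Definition _ := [isSub for orbit].
HB.instance Definition _ := [Choice of orbit_space by <:].
HB.instance Definition _ := [SubChoice_isSubLmodule of orbit_space by <:].

Implicit Types (x y z : orbit_space).

Lemma orbitD x y n : (x + y) n = x n + y n. Proof. by []. Qed.
Lemma orbitZ (a : R[i]) y n : (a *: y) n = a *: y n. Proof. by []. Qed.
Lemma orbitB x y n : (x - y) n = x n - y n. Proof. by []. Qed.

Lemma orbit_backward y n : A (y n.+2) = y n.+1.
Proof. by have /backwardP[] := orbitP y. Qed.

Lemma orbit_le y n : hnorm (y n.+1) <= hnorm (y n.+2).
Proof. by rewrite -orbit_backward contraction_le. Qed.

Lemma orbit_inj x y : (forall n, x n = y n) -> x = y.
Proof. by move=> xy; apply: val_inj; apply/funext. Qed.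

Definition blim y z : R := lim (rip (y n.+1) (z n.+1) @[n --> \oo]).

Lemma orbit_norm_cvg y :
  nondecreasing_seq (fun n => hnorm (y n.+1) ^+ 2) /\
  cvg (hnorm (y n.+1) ^+ 2 @[n --> \oo]).
Proof.
have [_ [c yc]] := backwardP _ (orbitP y).
have m : nondecreasing_seq (fun n => hnorm (y n.+1) ^+ 2).
  apply/nondecreasing_seqP => n; rewrite ler_pXn2r ?nnegrE ?hnorm_ge0 //.
  exact: orbit_le.
split=> //; apply: nondecreasing_is_cvgn => //; exists (c ^+ 2) => _ [n _ <-].
have c0 : 0 <= c by exact: le_trans (hnorm_ge0 (y 0%N)) (yc 0%N).
by rewrite ler_pXn2r ?nnegrE ?hnorm_ge0.
Qed.

(** Squared norms increase along a backward orbit and are bounded, so they converge; polarisation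
    transfers this to products. *)
Lemma blim_cvg y z : rip (y n.+1) (z n.+1) @[n --> \oo] --> blim y z.
Proof.
suff c : cvg (rip (y n.+1) (z n.+1) @[n --> \oo]) by exact: c.
have -> : (fun n => rip (y n.+1) (z n.+1)) =
    (fun n => 4^-1 * (hnorm ((y + z) n.+1) ^+ 2 - hnorm ((y - z) n.+1) ^+ 2)).
  apply/funext => n; by rewrite orbitD orbitB hnormD2 hnormB2; field.
have [_ c1] := orbit_norm_cvg (y + z); have [_ c2] := orbit_norm_cvg (y - z).
apply: cvgP; apply: cvgMl_tmp; exact: cvgB c1 c2.
Qed.

Lemma blim_eq y z l : rip (y n.+1) (z n.+1) @[n --> \oo] --> l -> blim y z = l.
Proof. by move=> yz; exact: cvg_lim. Qed.

Lemma blimC y z : blim y z = blim z y.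
Proof.
by apply: blim_eq; under eq_fun do rewrite ripC; exact: blim_cvg.
Qed.

Lemma blimD x y z : blim (x + y) z = blim x z + blim y z.
Proof.
apply: blim_eq; under eq_fun do rewrite orbitD ripDl.
by apply: cvgD; exact: blim_cvg.
Qed.

Lemma blimZ (a : R[i]) y z : blim (a *: y) z =
  complex.Re a * blim y z + complex.Im a * blim ('i *: y) z.
Proof.
apply: blim_eq.
have -> : (fun n => rip ((a *: y) n.+1) (z n.+1)) =
  (fun n => complex.Re a * rip (y n.+1) (z n.+1) +
            complex.Im a * rip (('i *: y) n.+1) (z n.+1)).
  apply/funext => n; rewrite !orbitZ -!ripZl -ripDl scalerA -scalerDl.
  by congr (rip (_ *: _) _); case: a => a b; simpc.
by apply: cvgD; apply: cvgMl_tmp; exact: blim_cvg.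
Qed.

Lemma blim_iC y z : blim ('i *: z) y = - blim ('i *: y) z.
Proof.
apply: blim_eq; have -> : (fun n => rip (('i *: z) n.+1) (y n.+1)) =
    (fun n => - rip (('i *: y) n.+1) (z n.+1)).
  apply/funext => n; rewrite !orbitZ /rip !innerZl (innerC (z n.+1)).
  by case: (inner _ _) => a b; rewrite /= !mul0r !mul1r !sub0r !opprK.
by apply: cvgN; exact: blim_cvg.
Qed.

Lemma blim_ge y n : hnorm (y n.+1) ^+ 2 <= blim y y.
Proof.
have [m c] := orbit_norm_cvg y.
have -> : blim y y = lim (hnorm (y n.+1) ^+ 2 @[n --> \oo]).
  by apply: blim_eq; under eq_fun do rewrite rip_hnorm.
exact: (nondecreasing_cvgn_le m c n).
Qed.

Lemma blim_le y c : (forall n, hnorm (y n.+1) ^+ 2 <= c) -> blim y y <= c.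
Proof.
move=> yc; have cy := @blim_cvg y y.
have -> : blim y y = lim (rip (y n.+1) (y n.+1) @[n --> \oo]) by [].
apply: limr_le; first exact: cvgP cy.
by apply: nearW => n; rewrite rip_hnorm.
Qed.

(** The second summand rebuilds a complex product from its real part, on the pattern of [innerE]. *)
Definition orbit_inner y z : R[i] :=
  '[y 0%N, z 0%N] + (blim y z +i* - blim ('i *: y) z).

Lemma orbit_innerC y z : orbit_inner y z = (-1) ^+ false * Num.conj (orbit_inner z y).
Proof.
rewrite expr0 mul1r /orbit_inner rmorphD [in LHS]innerC; congr (_ + _).
by rewrite (blimC z) (blim_iC y z) /= /conjc opprK.
Qed.

Lemma orbit_innerDl (a : R[i]) x y z :
  orbit_inner (a *: x + y) z = a * orbit_inner x z + orbit_inner y z.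
Proof.
rewrite /orbit_inner orbitD orbitZ innerDl innerZl blimD scalerDr blimD (blimZ a x).
have -> : 'i *: (a *: x) = a *: ('i *: x) by rewrite !scalerA mulrC.
rewrite (blimZ a ('i *: x)).
have -> : blim ('i *: ('i *: x)) z = - blim x z.
  by rewrite scalerA -expr2 sqr_i (blimZ (-1)) /= oppr0 mulN1r mul0r addr0.
move: '[x 0%N, z 0%N] '[y 0%N, z 0%N] => p q.
rewrite mulrDr addrACA; congr (_ + _).
case: a => a b; simpc; congr (_ +i* _); ring.
Qed.

Lemma orbit_inner_bilinear : bilinear_for
  (GRing.Scale.Law.clone _ _ ( *%R ) _) (GRing.Scale.Law.clone _ _ (@Num.conj R[i] \; *%R) _)
  orbit_inner.
Proof.
split=> [z a x y|z a x y] /=; first exact: orbit_innerDl.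
rewrite !(orbit_innerC z) expr0 !mul1r orbit_innerDl rmorphD rmorphM.
by [].
Qed.

HB.instance Definition _ := bilinear_isBilinear.Build R[i] orbit_space orbit_space R[i]
  ( *%R ) (@Num.conj R[i] \; *%R) orbit_inner orbit_inner_bilinear.
HB.instance Definition _ := isHermitianSesquilinear.Build R[i] orbit_space false
  (@Num.conj R[i]) orbit_inner orbit_innerC.

Lemma orbit_innerE y : orbit_inner y y = (hnorm (y 0%N) ^+ 2 + blim y y)%:C.
Proof.
rewrite /orbit_inner hnormC_sq; have := blim_iC y y => i0.
have -> : blim ('i *: y) y = 0 by lra.
by rewrite oppr0; simpc.
Qed.

Lemma blim_ge0 y : 0 <= blim y y.
Proof. exact: le_trans (sqr_ge0 _) (blim_ge y 0). Qed.

Lemma orbit_inner_gt0 y : y != 0 -> 0 < orbit_inner y y.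
Proof.
move=> y0; rewrite orbit_innerE ltcR lt_neqAle addr_ge0 ?sqr_ge0 ?blim_ge0 // andbT.
apply: contra y0; rewrite eq_sym paddr_eq0 ?sqr_ge0 ?blim_ge0 // => /andP[y0 /eqP yl].
apply/eqP/orbit_inj => -[|n]; apply/eqP.
  by rewrite -hnorm_eq0 -sqrf_eq0.
by rewrite -hnorm_eq0 -sqrf_eq0 eq_le sqr_ge0 andbT -yl blim_ge.
Qed.

HB.instance Definition _ := isDotProduct.Build R[i] orbit_space orbit_inner
  orbit_inner_gt0.

(** The formula that [rip] will have once [orbit_space] is a Hilbert space; see [orbit_ripE]. *)
Definition orbit_rip y z : R := rip (y 0%N) (z 0%N) + blim y z.

Definition orbit_norm y : R := Num.sqrt (orbit_rip y y).

Lemma orbit_rip_ge0 y : 0 <= orbit_rip y y.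
Proof. by rewrite /orbit_rip rip_hnorm addr_ge0 ?sqr_ge0 ?blim_ge0. Qed.

Lemma orbit_norm_sqr y : orbit_norm y ^+ 2 = orbit_rip y y.
Proof. by rewrite sqr_sqrtr ?orbit_rip_ge0. Qed.

Lemma orbit_normC_sqr y : orbit_inner y y = (orbit_norm y)%:C ^+ 2.
Proof. by rewrite orbit_innerE -rmorphXn orbit_norm_sqr /orbit_rip rip_hnorm. Qed.

Lemma orbit_norm_ge0 y : 0 <= orbit_norm y.
Proof. exact: sqrtr_ge0. Qed.

Lemma orbit_norm0 y : (orbit_norm y)%:C = 0 :> R[i] -> y = 0.
Proof.
move=> y0; apply/eqP; apply: contraTT (lexx (0 : R[i])) => /orbit_inner_gt0.
by rewrite orbit_normC_sqr y0 expr0n ltxx.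
Qed.

Lemma orbit_ripC y z : orbit_rip y z = orbit_rip z y.
Proof. by rewrite /orbit_rip ripC blimC. Qed.

Lemma orbit_ripD x y z : orbit_rip (x + y) z = orbit_rip x z + orbit_rip y z.
Proof. rewrite /orbit_rip orbitD ripDl blimD; ring. Qed.

Lemma orbit_ripZ (t : R) y z : orbit_rip (t%:C *: y) z = t * orbit_rip y z.
Proof. rewrite /orbit_rip orbitZ ripZl blimZ /=; ring. Qed.

Lemma orbit_rip_le x y : orbit_rip x y <= orbit_norm x * orbit_norm y.
Proof.
have [->|y0] := eqVneq y 0.
  have -> : orbit_rip x 0 = 0 by rewrite orbit_ripC -(scale0r x) orbit_ripZ mul0r.
  by rewrite mulr_ge0 ?orbit_norm_ge0.
have q0 : 0 < orbit_rip y y.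
  have := orbit_inner_gt0 y0; rewrite orbit_normC_sqr -rmorphXn ltcR.
  by rewrite orbit_norm_sqr.
apply: (le_trans (ler_norm _)).
rewrite -(@ler_pXn2r _ 2) ?nnegrE ?mulr_ge0 ?orbit_norm_ge0 //.
rewrite real_normK ?num_real // exprMn !orbit_norm_sqr.
set q := orbit_rip y y in q0 *; set b := orbit_rip x y; set p := orbit_rip x x.
(* The square of q x - b y is q (q p - b^2). *)
have := orbit_rip_ge0 (q%:C *: x + (- b)%:C *: y).
rewrite orbit_ripD !orbit_ripZ 2!(orbit_ripC _ (_ + _)) !orbit_ripD !orbit_ripZ.
rewrite (orbit_ripC y x) -/q -/b -/p => E.
have : 0 <= q * (q * p - b ^+ 2) by apply: le_trans E _; rewrite le_eqVlt; apply/orP; left; apply/eqP; ring.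
by rewrite pmulr_rge0 // subr_ge0 mulrC.
Qed.

Lemma orbit_normD x y :
  (orbit_norm (x + y))%:C <= (orbit_norm x)%:C + (orbit_norm y)%:C :> R[i].
Proof.
rewrite -rmorphD lecR -(@ler_pXn2r _ 2) ?nnegrE ?addr_ge0 ?orbit_norm_ge0 //.
rewrite sqrrD !orbit_norm_sqr orbit_ripD 2!(orbit_ripC _ (_ + _)) !orbit_ripD.
by rewrite (orbit_ripC y x); have := orbit_rip_le x y; lra.
Qed.

Lemma orbit_normZ (a : R[i]) y :
  (orbit_norm (a *: y))%:C = `|a| * (orbit_norm y)%:C :> R[i].
Proof.
rewrite -(Re_normE a) -rmorphM; congr _%:C; apply/eqP.
rewrite -(@eqrXn2 _ 2) ?mulr_ge0 ?orbit_norm_ge0 ?ReC_ge0 // exprMn !orbit_norm_sqr.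
rewrite /orbit_rip orbitZ !rip_hnorm hnormZ exprMn mulrDr; apply/eqP; congr (_ + _).
apply: blim_eq; under eq_fun do rewrite orbitZ rip_hnorm hnormZ exprMn -rip_hnorm.
by apply: cvgMl_tmp; exact: blim_cvg.
Qed.

HB.instance Definition _ := Lmodule_isNormed.Build R[i] orbit_space
  (norm := fun y => (orbit_norm y)%:C)
  orbit_normD orbit_normZ orbit_norm0.

End BackwardOrbits.

(** * Completeness of the orbit space *)

Section OrbitHilbert.
Context {R : realType} {H : hilbertType R}.
Variable A : contraction H.
Implicit Types (x y z : orbit_space A).

Lemma orbit_normE y : `|y| = (orbit_norm y)%:C. Proof. by []. Qed.

Lemma orbit_coord_le y n : hnorm (y n) <= orbit_norm y.
Proof.
rewrite -(@ler_pXn2r _ 2) ?nnegrE ?hnorm_ge0 ?orbit_norm_ge0 //.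
rewrite orbit_norm_sqr /orbit_rip rip_hnorm; case: n => [|n].
  by rewrite lerDl blim_ge0.
by rewrite (le_trans (blim_ge y n)) // lerDr sqr_ge0.
Qed.

(** Both summands of the squared norm are at most c^2. With [orbit_coord_le] the norm is thus
    equivalent to the supremum norm, and completeness can be checked entrywise. *)
Lemma orbit_norm_le y c : (forall n, hnorm (y n) <= c) -> orbit_norm y <= 2 * c.
Proof.
move=> yc; have c0 : 0 <= c by exact: le_trans (hnorm_ge0 _) (yc 0%N).
have sq n : hnorm (y n) ^+ 2 <= c ^+ 2 by rewrite ler_pXn2r ?nnegrE ?hnorm_ge0.
rewrite -(@ler_pXn2r _ 2) ?nnegrE ?mulr_ge0 ?orbit_norm_ge0 //.
rewrite orbit_norm_sqr /orbit_rip rip_hnorm.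
have : blim y y <= c ^+ 2 by apply: blim_le => n; exact: sq.
have := sq 0%N; have := sqr_ge0 c; rewrite exprMn; lra.
Qed.

Lemma orbit_ball x (e : R) y : ball x (e%:C : R[i]) y -> orbit_norm (x - y) < e.
Proof.
by rewrite -ball_normE => xy; rewrite -ltcR -orbit_normE; exact: xy.
Qed.

Lemma orbit_complete (F : set_system (orbit_space A)) :
  ProperFilter F -> cauchy F -> cvg F.
Proof.
move=> FF /cauchyP Fc; have lA := contraction_linear A.
have VC k : 0 < (k.+1%:R^-1 : R)%:C :> R[i] by rewrite ltcR invr_gt0.
have [u Fu] := choice (fun k => Fc _ (VC k)).
have e0 : (fun k => 2 * k.+1%:R^-1 : R) @ \oo --> (0 : R).
  by rewrite -(mulr0 2); apply: cvgMl_tmp; exact: cvg_harmonic.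
(* The balls around [u m] and [u k] belong to the same proper filter, hence meet. *)
have uC m k : (m <= k)%N -> orbit_norm (u k - u m) <= 2 * m.+1%:R^-1.
  move=> mk; have [w []] := filter_ex (filterI (Fu k) (Fu m)).
  move=> /orbit_ball wk /orbit_ball wm.
  rewrite -lecR -orbit_normE (_ : u k - u m = (u k - w) - (u m - w)); last first.
    by rewrite opprB addrA subrK.
  rewrite (le_trans (ler_normB _ _)) // !orbit_normE -rmorphD lecR.
  have : k.+1%:R^-1 <= m.+1%:R^-1 :> R by rewrite lef_pV2 ?posrE ?ltr0n // ler_nat.
  move: wk wm; move: (orbit_norm _) (orbit_norm _) (k.+1%:R^-1) (m.+1%:R^-1) => p q v w'; lra.
have lim n : exists l, forall k, hnorm (u k n - l) <= 2 * k.+1%:R^-1.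
  apply: hilbert_complete e0 _ => m k mk.
  by rewrite (le_trans (orbit_coord_le (u k - u m) n)) // uC.
have [l ul] := choice lim.
have lB : l \in backward A.
  apply/backwardP; split=> [n|].
    apply: (@hnorm_lim_eq _ _ _ _ (fun k => 2 * k.+1%:R^-1 + 2 * k.+1%:R^-1) 0).
      by rewrite -(addr0 0); apply: cvgD.
    move=> k _; rewrite (le_trans (hnorm_triB (u k n.+1) _ _)) // lerD //.
    rewrite -orbit_backward -linearfB // (le_trans (contraction_le A _)) //.
    by rewrite hdistC.
  exists (orbit_norm (u 0%N) + 2) => n.
  rewrite (_ : l n = u 0%N n - (u 0%N n - l n)); last by rewrite opprB addrC subrK.
  rewrite (le_trans (hnormB _ _)) // lerD ?orbit_coord_le //.
  by rewrite (le_trans (ul n 0%N)) // invr1 mulr1.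
apply/cvg_ex; exists (OrbitSpace lB); apply/fcvgrPdist_lt => e e_gt0.
have eR : (complex.Re e)%:C = e by rewrite RRe_real // gtr0_real.
have e_gt0' : 0 < complex.Re e by rewrite -ltcR eR.
have /cvg0P/(_ (complex.Re e / 4)) := e0; case=> [|N HN]; first by rewrite divr_gt0.
apply: filterS (Fu N) => w /orbit_ball wN.
rewrite -eR ltcR -ltcR -orbit_normE.
rewrite (_ : OrbitSpace lB - w = (u N - w) - (u N - OrbitSpace lB)); last first.
  by rewrite opprB [RHS]addrC addrA subrK.
rewrite (le_lt_trans (ler_normB _ _)) // !orbit_normE -rmorphD ltcR.
have := @orbit_norm_le (u N - OrbitSpace lB) _ (fun n => ul n N).
have := HN N (leqnn N); rewrite ger0_norm ?mulr_ge0 ?invr_ge0 //.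
have : 0 < N.+1%:R^-1 :> R by rewrite invr_gt0.
move: wN; move: (orbit_norm _) (orbit_norm _) (N.+1%:R^-1) (complex.Re e) => p q v d; lra.
Qed.

HB.instance Definition _ := Uniform_isComplete.Build (orbit_space A) orbit_complete.

Lemma orbit_inner_normE y : (@orbit_inner _ _ A) y y = `|y| ^+ 2.
Proof. exact: orbit_normC_sqr. Qed.

HB.instance Definition _ := isHilbert.Build R (orbit_space A) orbit_inner_normE.

End OrbitHilbert.

(** * The shift and its adjoint *)

Section Shift.
Context {R : realType} {H : hilbertType R}.
Variable A : contraction H.
Local Notation K := (orbit_space A).
Implicit Types (y z : K).

Lemma orbit_hnormE y : hnorm y = orbit_norm y. Proof. by []. Qed.

Lemma orbit_ripE y z : rip y z = orbit_rip y z.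
Proof.
rewrite -[LHS]/(complex.Re (orbit_inner y z)) /orbit_inner ReD.
by rewrite /orbit_rip /rip.
Qed.

Lemma shift_subproof y : (fun n => if n is m.+1 then y m.+2 else 0) \in backward A.
Proof.
have [_ [c yc]] := backwardP _ _ (orbitP y); apply/backwardP; split=> [n|].
  exact: orbit_backward.
exists c => -[|n //]; rewrite hnorm0.
exact: le_trans (hnorm_ge0 _) (yc 0%N).
Qed.

Definition shift y : K := OrbitSpace (shift_subproof y).

Lemma unshift_subproof y :
  (fun n => if n is m.+1 then A (y m.+1) else 0) \in backward A.
Proof.
have [_ [c yc]] := backwardP _ _ (orbitP y); apply/backwardP; split=> [n|].
  by rewrite orbit_backward.
exists c => -[|n]; first by rewrite hnorm0 (le_trans (hnorm_ge0 _) (yc 0%N)).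
by rewrite (le_trans (contraction_le A _)).
Qed.

Definition unshift y : K := OrbitSpace (unshift_subproof y).

Lemma shift_linear : linear shift.
Proof.
move=> a y z; apply: orbit_inj => -[|n]; rewrite orbitD orbitZ //=.
by rewrite scaler0 addr0.
Qed.

Lemma shift_norm_le y : hnorm (shift y) <= hnorm y.
Proof.
rewrite !orbit_hnormE -(@ler_pXn2r _ 2) ?nnegrE ?orbit_norm_ge0 //.
rewrite !orbit_norm_sqr /orbit_rip /= rip0l add0r rip_hnorm.
rewrite (@le_trans _ _ (blim y y)) ?lerDr ?sqr_ge0 //.
by apply: blim_le => n; exact: (blim_ge y n.+1).
Qed.

Lemma shift_bounded : bounded_operator shift.
Proof.
by split; [exact: shift_linear|exists 1 => y; rewrite mul1r shift_norm_le].
Qed.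

Lemma shift_normal : normal_operator shift.
Proof.
have adj : adjoint shift = unshift.
  apply: (adjoint_unique shift_bounded); apply: (is_adjoint_rip shift_linear) => y z.
  rewrite !orbit_ripE /orbit_rip /= rip0l ripr0; congr (_ + _).
  apply: blim_eq => /=.
  (* Moving the index by one does not change the limit and turns [A (z n.+2)] into [z n.+1]. *)
  have := @blim_cvg _ _ A y (unshift z).
  rewrite -(cvg_shiftS (fun n => rip (y n.+1) (unshift z n.+1))) /=.
  by under eq_fun do rewrite orbit_backward.
(* Both compositions have entry 0 equal to 0 and entry [n.+1] equal to [A (y n.+2)]. *)
rewrite /normal_operator adj; apply/funext => y; apply: orbit_inj => -[|n] //=.
Qed.

End Shift.

(** * The normal extension *)

Section NormalExtension.
Context {R : realType} {H : hilbertType R}.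
Variables (T : H -> H) (bT : bounded_operator T).
Hypothesis cT : forall h, hnorm (T h) <= hnorm h.

Lemma adjoint_contraction h : hnorm (adjoint T h) <= hnorm h.
Proof.
have [->|Sh] := eqVneq (adjoint T h) 0; first by rewrite hnorm0 hnorm_ge0.
rewrite -(ler_pM2l (_ : 0 < hnorm (adjoint T h))) ?hnorm_gt0 //.
rewrite -expr2 -rip_hnorm -rip_adjoint // (le_trans (rip_le _ _)) //.
by rewrite ler_wpM2r ?hnorm_ge0.
Qed.

Definition adjoint_contr : contraction H :=
  Contraction (adjointP bT).1.1 adjoint_contraction.

Lemma B1_subnormal : B1 T \o T = 0 -> subnormal T.
Proof.
move=> BT; have lT := bT.1.
have TTT h : adjoint T (T (T h)) = T h.
  have := congr1 (fun f : H -> H => f h) BT.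
  by rewrite op0E /= /B1 !opE => /eqP; rewrite subr_eq0 => /eqP.
have iT h : hnorm (T (T h)) ^+ 2 = hnorm (T h) ^+ 2.
  by rewrite -rip_hnorm -rip_adjointl // TTT rip_hnorm.
have iTn n h : hnorm (iter n.+1 T h) ^+ 2 = hnorm (T h) ^+ 2.
  by elim: n => // n IH; rewrite !iterS iT -iterS IH.
have [S [lS SE]] := defect_root bT cT.
(* The orbit condition is [TTT]: the adjoint undoes T on its range. *)
have VP h : (fun n => if n is m.+1 then iter m.+1 T h else S h) \in backward adjoint_contr.
  apply/backwardP; split=> [n|]; first by rewrite /= TTT.
  exists (hnorm h) => n; rewrite -(@ler_pXn2r _ 2) ?nnegrE ?hnorm_ge0 //.
  case: n => [|n]; first by rewrite SE gerBl sqr_ge0.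
  by rewrite iTn ler_pXn2r ?nnegrE ?hnorm_ge0.
pose V h : orbit_space adjoint_contr := OrbitSpace (VP h).
exists (orbit_space adjoint_contr), V, (@shift _ _ adjoint_contr); split.
- move=> a x y; apply: orbit_inj => -[|n]; first exact: lS.
  exact: (linear_iter n.+1 lT a x y).
- move=> h; rewrite orbit_normE -hnormE; congr _%:C; apply/eqP.
  rewrite -(@eqrXn2 _ 2) ?orbit_norm_ge0 ?hnorm_ge0 // orbit_norm_sqr /orbit_rip.
  have -> : blim (V h) (V h) = hnorm (T h) ^+ 2.
    by apply: blim_eq; under eq_fun do rewrite rip_hnorm iTn; exact: cvg_cst.
  by rewrite rip_hnorm SE subrK.
- exact: shift_bounded.
- exact: shift_normal.
move=> h; apply: orbit_inj => -[|n]; last by rewrite /= -iterSr.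
(* At entry 0 the shift gives 0, and [S (T h) = 0] because T preserves the norm of [T h]. *)
by apply/eqP; rewrite /= -hnorm_eq0 -sqrf_eq0 SE iT subrr.
Qed.

End NormalExtension.

Theorem proposition4p3p5 (R : realType) (H : hilbertType R) (T : H -> H)
    (bT : bounded_operator T) :
  [<-> (* (i) *)
       CPD T /\ (exists2 M : semispectral H,
                   associated_semispectral T M & msupp M = [set 0]);
       (* (ii) *)
       [/\ B2 T \o T = 0, positive_operator (B2 T) & B2 T <> 0];
       (* (iii) *)
       [/\ forall n : nat, (1 <= n)%N ->
             hpow T n = idfun - B2 T + (B2 T - B1 T) *+ n,
           positive_operator (B2 T) & B2 T <> 0];
       (* (iv) *)
       exists (F : semispectral H) (D : H -> H),
         [/\ msupp F = [set 0],
             bounded_operator D /\ selfadjoint D,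
             F `[1, +oo[%classic = 0,
             smeas_L1 F (fun x => (1 / (1 - x))%:C) &
             forall n : nat,
               hpow T n = idfun + D *+ n
                 - smeas_integral F `[0, 1[
                     (fun x => ((1 - x ^+ n) / (1 - x) ^+ 2)%:C)]] /\
  (CPD T /\ (exists2 M : semispectral H,
               associated_semispectral T M & msupp M = [set 0]) ->
   (* (a) *)
   (T <> 0 -> spectral_radius T = 1) /\
   (* (b) *)
   (subnormal T <-> B1 T \o T = 0 /\ opnorm T <= 1) /\
   (subnormal T -> T <> 0 -> opnorm T = 1)).
Proof.
(* Isolated because (a) and (b) use (i) through [B2 T \o T = 0]. *)
have i_ii : CPD T /\ (exists2 M : semispectral H,
    associated_semispectral T M & msupp M = [set 0]) ->
    [/\ B2 T \o T = 0, positive_operator (B2 T) & B2 T <> 0].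
  move=> /i_to_affine[C [pC C0] [D E]]; exact: (@affine_to_ii _ _ T bT C D pC C0 E).
split.
  tfae=> //.
  - by move=> [BT pB B0]; split=> // n n1; exact: hpow_affine.
  - by move=> [E pB B0]; exact: iii_to_iv.
  - by move=> [F [D [suppF _ _ _ E]]]; exact: iv_to_i suppF E.
move=> /i_ii[BT _ _]; split; first exact: spectral_radius_eq1.
split; last exact: subnormal_opnorm.
split; first exact: subnormal_B1.
by move=> [B1T /(opnorm_le1P bT)]; move=> cT; exact: B1_subnormal cT B1T.
Qed.
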